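(* Let $q\in\mathbb{C}\setminus\{0\}$ be not a root of unity. For any $m\ge 3$, all module-algebra structures of $U_q(sl(m+1))$ on $A_q(2)$ are as follows: $$k_i(x_1)=\pm x_1,\qquad k_i(x_2)=\pm x_2,\qquad e_i(x_1)=e_i(x_2)=f_i(x_1)=f_i(x_2)=0$$ for any $i\in\{1,\dots,m\}$ (all signs arbitrary).
   Context: All algebras and vector spaces are over $\mathbb{C}$. $U_q(sl(m+1))$ ($m\ge 1$) is the unital algebra generated by $e_i,f_i,k_i,k_i^{-1}$ ($1\le i\le m$) with relations $k_ik_i^{-1}=k_i^{-1}k_i=1$, $k_ik_j=k_jk_i$, $k_ie_jk_i^{-1}=q^{a_{ij}}e_j$, $k_if_jk_i^{-1}=q^{-a_{ij}}f_j$, $[e_i,f_j]=\delta_{ij}\frac{k_i-k_i^{-1}}{q-q^{-1}}$; $e_ie_j=e_je_i$ and $f_if_j=f_jf_i$ if $a_{ij}=0$; $e_i^2e_j-(q+q^{-1})e_ie_je_i+e_je_i^2=0$ and $f_i^2f_j-(q+q^{-1})f_if_jf_i+f_jf_i^2=0$ if $a_{ij}=-1$. Here $a_{ii}=2$, $a_{ij}=-1$ if $|i-j|=1$, $a_{ij}=0$ if $|i-j|>1$. Its Hopf algebra structure is $\Delta(e_i)=1\otimes e_i+e_i\otimes k_i$, $\Delta(f_i)=k_i^{-1}\otimes f_i+f_i\otimes 1$, $\Delta(k_i^{\pm1})=k_i^{\pm1}\otimes k_i^{\pm1}$, $\varepsilon(k_i^{\pm1})=1$, $\varepsilon(e_i)=\varepsilon(f_i)=0$,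 $S(e_i)=-e_ik_i^{-1}$, $S(f_i)=-k_if_i$, $S(k_i^{\pm1})=k_i^{\mp1}$. $A_q(2)$ is the unital algebra generated by $x_1,x_2$ with relation $x_2x_1=qx_1x_2$. An $H$-module algebra structure on a unital algebra $A$, for a Hopf algebra $H$, is an algebra homomorphism $\pi:H\to \mathrm{End}_{\mathbb{C}}A$ with $\pi(h)(ab)=\sum_i\pi(h_i')(a)\pi(h_i'')(b)$ (where $\Delta(h)=\sum_i h_i'\otimes h_i''$) and $\pi(h)(1)=\varepsilon(h)1$; one writes $h(a)$ for $\pi(h)(a)$. It is determined by the values of the generators of $H$ on the generators of $A$. *)

(* Defs.v *)
From HB Require Import structures.
From mathcomp Require Import all_boot all_order all_algebra.
From mathcomp Require Import generic_quotient.
From mathcomp Require Import boolp classical_sets reals.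
From mathcomp Require Import complex.
From mathcomp Require Import ring.

Set Implicit Arguments.
Unset Strict Implicit.
Unset Printing Implicit Defensive.

Import GRing.Theory.
Local Open Scope ring_scope.
Local Open Scope quotient_scope.

Record algebra_morphism (K : pzRingType) (A B : algType K) (f : A -> B)
    : Prop := AlgebraMorphism {
  algmor_linear : linear f;
  algmor_one : f 1 = 1;
  algmor_mul : {morph f : a b / a * b}
}.

Inductive aterm (K X : Type) : Type :=
| AGen of X
| AScalar of K
| AAdd of aterm K X & aterm K X
| AMul of aterm K X & aterm K X.
Arguments AGen {K X} x.
Arguments AScalar {K X} c.

Declare Scope aterm_scope.
Delimit Scope aterm_scope with AT.
Bind Scope aterm_scope with aterm.
Notation "1" := (AScalar 1%R) : aterm_scope.
Notation "0" := (AScalar 0%R) : aterm_scope.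
Notation "t + u" := (AAdd t u) : aterm_scope.
Notation "t * u" := (AMul t u) : aterm_scope.
Notation "c *: t" := (AMul (AScalar c%R) t) : aterm_scope.
Notation "t - u" := (AAdd t (AMul (AScalar (-1)%R) u)) : aterm_scope.

HB.instance Definition _ (K X : Type) := gen_eqMixin (aterm K X).
HB.instance Definition _ (K X : Type) := gen_choiceMixin (aterm K X).

Fixpoint aeval (K : fieldType) (X : Type) (A : algType K) (g : X -> A)
    (t : aterm K X) : A :=
  match t with
  | AGen x => g x
  | AScalar c => c *: 1
  | AAdd t u => aeval g t + aeval g u
  | AMul t u => aeval g t * aeval g u
  end.

(** An [algType] is nonzero, so a presentation comes with a one-dimensional
    representation of the relations. *)
Record presentation (K : fieldType) (X : Type) := Presentation {
  prel :> aterm K X -> aterm K X -> Prop;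
  prel_point : exists g : X -> K^o,
    forall t u, prel t u -> aeval g t = aeval g u
}.

Section Presentation.
Variables (K : fieldType) (X : Type).
Variable rel : presentation K X.

(** The least congruence which contains [rel] and makes the quotient a unital
    associative [K]-algebra. *)
Inductive acong : aterm K X -> aterm K X -> Prop :=
| acong_rel t u : rel t u -> acong t u
| acong_refl t : acong t t
| acong_sym t u : acong t u -> acong u t
| acong_trans t u v : acong t u -> acong u v -> acong t v
| acongD t t' u u' : acong t t' -> acong u u' -> acong (t + u) (t' + u')
| acongM t t' u u' : acong t t' -> acong u u' -> acong (t * u) (t' * u')
| acong_addA t u v : acong (t + (u + v)) (t + u + v)
| acong_addC t u : acong (t + u) (u + t)
| acong_add0 t : acong (0 + t) t
| acong_mulA t u v : acong (t * (u * v)) (t * u * v)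
| acong_mul1l t : acong (1 * t) t
| acong_mul1r t : acong (t * 1) t
| acong_mulDl t u v : acong ((t + u) * v) (t * v + u * v)
| acong_mulDr t u v : acong (t * (u + v)) (t * u + t * v)
| acong_scalarD c d : acong (AScalar (c + d)%R) (AScalar c + AScalar d)
| acong_scalarM c d : acong (AScalar (c * d)%R) (AScalar c * AScalar d)
| acong_scalar0 t : acong (0 * t) 0
| acong_scalarC c t : acong (AScalar c * t) (t * AScalar c).

Lemma aeval_acong (A : algType K) (g : X -> A) t u :
  (forall t u, rel t u -> aeval g t = aeval g u) -> acong t u -> aeval g t = aeval g u.
Proof.
move=> g_rel; elim=> {t u}//=.
- by move=> t u v _ -> _ ->.
- by move=> t t' u u' _ -> _ ->.
- by move=> t t' u u' _ -> _ ->.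
- by move=> *; rewrite addrA.
- by move=> *; rewrite addrC.
- by move=> *; rewrite scale0r add0r.
- by move=> *; rewrite mulrA.
- by move=> *; rewrite scale1r mul1r.
- by move=> *; rewrite scale1r mulr1.
- by move=> *; rewrite mulrDl.
- by move=> *; rewrite mulrDr.
- by move=> *; rewrite scalerDl.
- by move=> *; rewrite -scalerAl mul1r scalerA.
- by move=> *; rewrite scale0r mul0r.
- by move=> *; rewrite -scalerAl -scalerAr mul1r mulr1.
Qed.

Definition acongb (t u : aterm K X) := `[< acong t u >].

Lemma acongb_refl : reflexive acongb.
Proof. by move=> t; apply/asboolP/acong_refl. Qed.

Lemma acongb_sym : symmetric acongb.
Proof. by move=> t u; apply/asboolP/asboolP => /acong_sym. Qed.

Lemma acongb_trans : transitive acongb.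
Proof.
move=> u t v /asboolP tu /asboolP uv; apply/asboolP; exact: acong_trans tu uv.
Qed.

Canonical acong_equiv := EquivRel acongb acongb_refl acongb_sym acongb_trans.

Definition presented_algebra := {eq_quot acong_equiv}.
HB.instance Definition _ := Choice.on presented_algebra.
Local Notation P := presented_algebra.

Definition pclass (t : aterm K X) : P := \pi_({eq_quot acong_equiv}) t.

Lemma pclassP t u : pclass t = pclass u <-> acong t u.
Proof.
split=> [/eqP|tu]; first by rewrite /pclass eqquotE => /asboolP.
by apply/eqP; rewrite /pclass eqquotE; apply/asboolP.
Qed.

Lemma prepr_cong t : acong (repr (pclass t)) t.
Proof. by apply/pclassP; rewrite /pclass reprK. Qed.

Lemma pclass_repr (a : P) : pclass (repr a) = a.
Proof. exact: reprK. Qed.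

Lemma pclass_ind (Q : P -> Prop) : (forall t, Q (pclass t)) -> forall a, Q a.
Proof. by move=> h a; rewrite -(pclass_repr a). Qed.

Definition padd (a b : P) : P := pclass (repr a + repr b)%AT.
Definition popp (a : P) : P := pclass ((-1) *: repr a)%AT.
Definition pmul (a b : P) : P := pclass (repr a * repr b)%AT.
Definition pscale (c : K) (a : P) : P := pclass (c *: repr a)%AT.

Lemma pclassD t u : padd (pclass t) (pclass u) = pclass (t + u)%AT.
Proof. by apply/pclassP/acongD; apply: prepr_cong. Qed.

Lemma pclassM t u : pmul (pclass t) (pclass u) = pclass (t * u)%AT.
Proof. by apply/pclassP/acongM; apply: prepr_cong. Qed.

Lemma pclassZ c t : pscale c (pclass t) = pclass (c *: t)%AT.
Proof. by apply/pclassP/acongM; [apply: acong_refl|apply: prepr_cong]. Qed.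

Lemma pclassN t : popp (pclass t) = pclass ((-1) *: t)%AT.
Proof. exact: pclassZ. Qed.

Lemma paddA : associative padd.
Proof.
elim/pclass_ind=> a; elim/pclass_ind=> b; elim/pclass_ind=> c.
by rewrite !pclassD; apply/pclassP/acong_addA.
Qed.

Lemma paddC : commutative padd.
Proof.
elim/pclass_ind=> a; elim/pclass_ind=> b.
by rewrite !pclassD; apply/pclassP/acong_addC.
Qed.

Lemma padd0 : left_id (pclass 0%AT) padd.
Proof.
by elim/pclass_ind=> a; rewrite pclassD; apply/pclassP/acong_add0.
Qed.

Lemma paddN : left_inverse (pclass 0%AT) popp padd.
Proof.
elim/pclass_ind=> a; rewrite pclassN pclassD; apply/pclassP.
apply: acong_trans (acong_scalar0 a).
apply: (@acong_trans _ ((-1) *: a + 1 * a)%AT).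
  by apply: acongD; [apply: acong_refl|apply/acong_sym/acong_mul1l].
apply: acong_trans (acong_sym (acong_mulDl _ _ _)) _.
apply: acongM; last exact: acong_refl.
by apply: acong_sym; rewrite -[in X in acong X _](addNr (1 : K)); apply: acong_scalarD.
Qed.

HB.instance Definition _ := GRing.isZmodule.Build P paddA paddC padd0 paddN.

Lemma pmulA : associative pmul.
Proof.
elim/pclass_ind=> a; elim/pclass_ind=> b; elim/pclass_ind=> c.
by rewrite !pclassM; apply/pclassP/acong_mulA.
Qed.

Lemma pmul1l : left_id (pclass 1%AT) pmul.
Proof. by elim/pclass_ind=> a; rewrite pclassM; apply/pclassP/acong_mul1l. Qed.

Lemma pmul1r : right_id (pclass 1%AT) pmul.
Proof. by elim/pclass_ind=> a; rewrite pclassM; apply/pclassP/acong_mul1r. Qed.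

Lemma pmulDl : left_distributive pmul +%R.
Proof.
elim/pclass_ind=> a; elim/pclass_ind=> b; elim/pclass_ind=> c.
by rewrite /GRing.add/= !(pclassD, pclassM); apply/pclassP/acong_mulDl.
Qed.

Lemma pmulDr : right_distributive pmul +%R.
Proof.
elim/pclass_ind=> a; elim/pclass_ind=> b; elim/pclass_ind=> c.
by rewrite /GRing.add/= !(pclassD, pclassM); apply/pclassP/acong_mulDr.
Qed.

Lemma pone_neq0 : pclass 1%AT != pclass 0%AT.
Proof.
apply/eqP => /pclassP; case: (prel_point rel) => g g_rel.
move=> /(aeval_acong g_rel)/eqP.
by rewrite /= scale1r scale0r oner_eq0.
Qed.

HB.instance Definition _ :=
  GRing.Zmodule_isNzRing.Build P pmulA pmul1l pmul1r pmulDl pmulDr pone_neq0.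

Lemma pscaleA (c d : K) (a : P) : pscale c (pscale d a) = pscale (c * d) a.
Proof.
elim/pclass_ind: a => a; rewrite !pclassZ; apply/pclassP.
apply: acong_trans (acong_mulA _ _ _) _; apply: acongM (acong_refl _).
exact/acong_sym/acong_scalarM.
Qed.

Lemma pscale1 : left_id 1 pscale.
Proof. by elim/pclass_ind=> a; rewrite pclassZ; apply/pclassP/acong_mul1l. Qed.

Lemma pscaleDr : right_distributive pscale +%R.
Proof.
move=> c; elim/pclass_ind=> a; elim/pclass_ind=> b.
by rewrite /GRing.add/= !(pclassD, pclassZ); apply/pclassP/acong_mulDr.
Qed.

Lemma pscaleDl (a : P) : {morph pscale^~ a : c d / c + d}.
Proof.
move=> c d; elim/pclass_ind: a => a; rewrite !pclassZ [RHS]pclassD.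
apply/pclassP; apply: acong_trans (acong_mulDl _ _ _).
exact: acongM (acong_scalarD _ _) (acong_refl _).
Qed.

HB.instance Definition _ :=
  GRing.Zmodule_isLmodule.Build K P pscaleA pscale1 pscaleDr pscaleDl.

Lemma pscaleAl (c : K) (a b : P) : c *: (a * b) = (c *: a) * b.
Proof.
elim/pclass_ind: a => a; elim/pclass_ind: b => b.
rewrite /GRing.scale/= /GRing.mul/= !(pclassM, pclassZ).
exact/pclassP/acong_mulA.
Qed.

Lemma pscaleAr (c : K) (a b : P) : c *: (a * b) = a * (c *: b).
Proof.
elim/pclass_ind: a => a; elim/pclass_ind: b => b.
rewrite /GRing.scale/= /GRing.mul/= !(pclassM, pclassZ); apply/pclassP.
apply: acong_trans (acong_mulA _ _ _) _.
apply: acong_trans (acong_sym (acong_mulA _ _ _)).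
exact: acongM (acong_scalarC _ _) (acong_refl _).
Qed.

HB.instance Definition _ := GRing.Lmodule_isLalgebra.Build K P pscaleAl.
HB.instance Definition _ := GRing.Lalgebra_isAlgebra.Build K P pscaleAr.

Definition pgen (x : X) : P := pclass (AGen x).

Lemma aeval_pgen t : aeval pgen t = pclass t.
Proof.
elim: t => [x|c|t IHt u IHu|t IHt u IHu] //=.
- rewrite [LHS]pclassZ; exact/pclassP/acong_mul1r.
- by rewrite IHt IHu; apply: pclassD.
- by rewrite IHt IHu; apply: pclassM.
Qed.

Lemma pgen_rel t u : rel t u -> aeval pgen t = aeval pgen u.
Proof. by move=> tu; rewrite !aeval_pgen; apply/pclassP/acong_rel. Qed.

(** The map induced by an assignment [g] of the generators; it is an algebra
    morphism extending [g] as soon as [g] satisfies the relations, see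
    [pliftP] and [plift_gen]. *)
Definition plift (A : algType K) (g : X -> A) (a : P) : A := aeval g (repr a).

Section Lift.
Variables (A : algType K) (g : X -> A).
Hypothesis g_rel : forall t u, rel t u -> aeval g t = aeval g u.

Lemma plift_class t : plift g (pclass t) = aeval g t.
Proof. exact/(aeval_acong g_rel)/prepr_cong. Qed.

Lemma plift_gen x : plift g (pgen x) = g x.
Proof. exact: plift_class. Qed.

Lemma pliftP : algebra_morphism (plift g).
Proof.
split.
- move=> c; elim/pclass_ind=> a; elim/pclass_ind=> b.
  rewrite /GRing.scale/= /GRing.add/= pclassZ pclassD !plift_class /=.
  by rewrite -scalerAl mul1r.
- by rewrite plift_class /= scale1r.
- elim/pclass_ind=> a; elim/pclass_ind=> b.
  by rewrite [in LHS]/GRing.mul/= pclassM !plift_class.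
Qed.

End Lift.
End Presentation.

Arguments pgen {K X} rel x.

Lemma linear_form_neq0 (K : fieldType) (V : lmodType K) (v : V) : v != 0 ->
  exists2 phi : V -> K^o, linear phi & phi v != 0.
Proof.
move=> v0.
pose P (W : set V) :=
  ~ W v /\ forall c x y, W x -> W y -> W (c *: x + y).
have [F FP Ftot|W [[Wv Wlin] Wmax]] := @Zorn_bigcup V P.
  split=> [[X FX Xv]|c x y [X FX Xx] [Y FY Yy]]; first by case: (FP _ FX).
  have [XY|YX] := Ftot _ _ FX FY.
    by exists Y => //; apply: (proj2 (FP _ FY)) => //; apply: XY.
  by exists X => //; apply: (proj2 (FP _ FX)) => //; apply: YX.
have W0 : W 0.
  apply: contrapT => W0.
  have WF x : ~ W x.
    by move=> Wx; apply: W0; rewrite -(addNr x) -scaleN1r; apply: Wlin.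
  apply: (Wmax [set 0]%classic).
    split=> [/= x /WF//|]; move=> /(_ 0 erefl); exact: W0.
  split=> [/= vE|c x y /= -> ->]; first by rewrite vE eqxx in v0.
  by rewrite scaler0 addr0.
have WZ c x : W x -> W (c *: x) by move=> Wx; rewrite -[_ *: _]addr0; apply: Wlin.
have WD x y : W x -> W y -> W (x + y).
  by move=> Wx Wy; rewrite -[x]scale1r; apply: Wlin.
have WB x y : W x -> W y -> W (x - y).
  by move=> Wx Wy; rewrite -scaleN1r addrC; apply: Wlin.
have ex x : exists c, W (x - c *: v).
  apply: contrapT => nex.
  have nWx : ~ W x by move=> Wx; apply: nex; exists 0; rewrite scale0r subr0.
  apply: (Wmax [set y | exists d w, W w /\ y = d *: x + w]%classic).
    split=> [y Wy /=|]; first by exists 0, y; rewrite scale0r add0r.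
    by move=> /(_ x) H; apply/nWx/H; exists 1, 0; rewrite scale1r addr0.
  split=> /= [[d [w [Ww vE]]]|c y z [d [w [Ww ->]]] [d' [w' [Ww' ->]]]].
    have [d0|d0] := eqVneq d 0.
      by apply: Wv; rewrite vE d0 scale0r add0r.
    apply: nex; exists d^-1; rewrite vE scalerDr scalerA mulVf // scale1r.
    by rewrite opprD addrA subrr sub0r -scaleN1r; apply/WZ/WZ.
  exists (c * d + d'), (c *: w + w'); split; first exact: Wlin.
  by rewrite scalerDr scalerA scalerDl addrACA.
have uniq x c d : W (x - c *: v) -> W (x - d *: v) -> c = d.
  move=> Wc Wd; have [//|cd] := eqVneq c d.
  case: Wv; have -> : v = (c - d)^-1 *: ((x - d *: v) - (x - c *: v)).
    rewrite opprB [X in _ *: X]addrC addrA subrK -scalerBl scalerA mulVf ?scale1r //.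
    by rewrite subr_eq0.
  by apply: WZ; apply: WB.
pose phi x := projT1 (cid (ex x)).
have phiP x : W (x - phi x *: v) by rewrite /phi; case: cid.
exists phi; last first.
  apply/eqP => phiv; apply: Wv; have := phiP v.
  by rewrite phiv scale0r subr0.
move=> c x y; apply: (uniq (c *: x + y)) => //.
rewrite scalerDl opprD addrACA; apply: WD => //.
by rewrite -scalerA -scalerBr; apply: WZ.
Qed.

Record bilinear_map (K : pzRingType) (A B V : lmodType K) (beta : A -> B -> V)
    : Prop := BilinearMap {
  bilin_l : forall b, linear (beta^~ b);
  bilin_r : forall a, linear (beta a)
}.

Definition formal_tensor (A B : Type) := seq (A * B).
HB.instance Definition _ (A B : Type) := gen_eqMixin (formal_tensor A B).
HB.instance Definition _ (A B : Type) := gen_choiceMixin (formal_tensor A B).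

Section Tensor.
Variable K : fieldType.

Section Space.
Variables A B : lmodType K.

(** The list [(a1, b1); ...; (an, bn)] stands for the sum of the [ai (x) bi];
    two formal sums are the same tensor if and only if no bilinear map tells
    them apart. *)
Definition tensor_eq (s t : formal_tensor A B) : Prop :=
  forall (V : lmodType K) (beta : A -> B -> V), bilinear_map beta ->
    \sum_(p <- s) beta p.1 p.2 = \sum_(p <- t) beta p.1 p.2.

Definition tensor_eqb (s t : formal_tensor A B) := `[< tensor_eq s t >].

Lemma tensor_eqb_refl : reflexive tensor_eqb.
Proof. by move=> s; apply/asboolP. Qed.

Lemma tensor_eqb_sym : symmetric tensor_eqb.
Proof.
by move=> s t; apply/asboolP/asboolP => st V beta hb; rewrite st.
Qed.

Lemma tensor_eqb_trans : transitive tensor_eqb.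
Proof.
move=> t s u /asboolP st /asboolP tu; apply/asboolP => V beta hb.
by rewrite st // tu.
Qed.

Canonical tensor_equiv :=
  EquivRel tensor_eqb tensor_eqb_refl tensor_eqb_sym tensor_eqb_trans.

Definition tensor := {eq_quot tensor_equiv}.
HB.instance Definition _ := Choice.on tensor.

Definition tclass (s : formal_tensor A B) : tensor :=
  \pi_({eq_quot tensor_equiv}) s.

Definition pure (a : A) (b : B) : tensor := tclass [:: (a, b)].

Lemma tclassP s t : tclass s = tclass t <-> tensor_eq s t.
Proof.
split=> [/eqP|st]; first by rewrite /tclass eqquotE => /asboolP.
by apply/eqP; rewrite /tclass eqquotE; apply/asboolP.
Qed.

Lemma trepr_eq s : tensor_eq (repr (tclass s)) s.
Proof. by apply/tclassP; rewrite /tclass reprK. Qed.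

Lemma tclass_ind (Q : tensor -> Prop) : (forall s, Q (tclass s)) -> forall t, Q t.
Proof. by move=> h t; rewrite -[t]reprK; apply: h. Qed.

Definition fscale (c : K) (s : formal_tensor A B) : formal_tensor A B :=
  [seq (c *: p.1, p.2) | p <- s].

Definition tadd (s t : tensor) : tensor := tclass (repr s ++ repr t).
Definition tscale (c : K) (s : tensor) : tensor := tclass (fscale c (repr s)).
Definition topp (s : tensor) : tensor := tscale (-1) s.

Lemma fscaleE (V : lmodType K) (beta : A -> B -> V) c s : bilinear_map beta ->
  \sum_(p <- fscale c s) beta p.1 p.2 = c *: \sum_(p <- s) beta p.1 p.2.
Proof.
move=> hb; rewrite big_map scaler_sumr; apply: eq_bigr => p _ /=.
have /(_ c p.1 0) := bilin_l hb p.2; rewrite addr0 => ->.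
have /(_ (-1) 0 0) := bilin_l hb p.2.
by rewrite addr0 scaler0 scaleN1r addNr => ->; rewrite addr0.
Qed.

Lemma tclassD s t : tadd (tclass s) (tclass t) = tclass (s ++ t).
Proof.
by apply/tclassP => V beta hb; rewrite !big_cat /= !(trepr_eq _ hb).
Qed.

Lemma tclassZ c s : tscale c (tclass s) = tclass (fscale c s).
Proof.
by apply/tclassP => V beta hb; rewrite !fscaleE // !(trepr_eq _ hb).
Qed.

Lemma taddA : associative tadd.
Proof.
elim/tclass_ind=> s; elim/tclass_ind=> t; elim/tclass_ind=> u.
by rewrite !tclassD catA.
Qed.

Lemma taddC : commutative tadd.
Proof.
elim/tclass_ind=> s; elim/tclass_ind=> t; rewrite !tclassD.
by apply/tclassP => V beta hb; rewrite !big_cat /= addrC.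
Qed.

Lemma tadd0 : left_id (tclass [::]) tadd.
Proof. by elim/tclass_ind=> s; rewrite tclassD. Qed.

Lemma taddN : left_inverse (tclass [::]) topp tadd.
Proof.
elim/tclass_ind=> s; rewrite /topp tclassZ tclassD.
apply/tclassP => V beta hb.
by rewrite big_cat /= fscaleE // scaleN1r addNr big_nil.
Qed.

HB.instance Definition _ := GRing.isZmodule.Build tensor taddA taddC tadd0 taddN.

Lemma tscaleA c d (s : tensor) : tscale c (tscale d s) = tscale (c * d) s.
Proof.
elim/tclass_ind: s => s; rewrite !tclassZ.
by apply/tclassP => V beta hb; rewrite !fscaleE // scalerA.
Qed.

Lemma tscale1 : left_id 1 tscale.
Proof.
elim/tclass_ind=> s; rewrite tclassZ.
by apply/tclassP => V beta hb; rewrite fscaleE // scale1r.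
Qed.

Lemma tscaleDr : right_distributive tscale +%R.
Proof.
move=> c; elim/tclass_ind=> s; elim/tclass_ind=> t.
rewrite /GRing.add/= !(tclassD, tclassZ).
by rewrite /fscale map_cat.
Qed.

Lemma tscaleDl (s : tensor) : {morph tscale^~ s : c d / c + d}.
Proof.
move=> c d; elim/tclass_ind: s => s; rewrite !tclassZ [RHS]tclassD.
apply/tclassP => V beta hb.
by rewrite big_cat /= !fscaleE // scalerDl.
Qed.

HB.instance Definition _ :=
  GRing.Zmodule_isLmodule.Build K tensor tscaleA tscale1 tscaleDr tscaleDl.

Lemma tclass_sum (s : seq (A * B)) : tclass s = \sum_(p <- s) pure p.1 p.2.
Proof.
elim: s => [|[a b] s IHs]; first by rewrite big_nil.
by rewrite big_cons -IHs [RHS]tclassD.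
Qed.

Lemma pure_bilinear : bilinear_map pure.
Proof.
split=> [b c a a'|a c b b'].
- rewrite /pure [in RHS]/GRing.scale/= [in RHS]/GRing.add/= tclassZ tclassD.
  apply/tclassP => V beta hb; rewrite big_cat (fscaleE c _ hb) !big_seq1 /=.
  exact: (bilin_l hb b).
- rewrite /pure [in RHS]/GRing.scale/= [in RHS]/GRing.add/= tclassZ tclassD.
  apply/tclassP => V beta hb; rewrite big_cat (fscaleE c _ hb) !big_seq1 /=.
  exact: (bilin_r hb a).
Qed.

Lemma pureDl (a a' : A) (b : B) : pure (a + a') b = pure a b + pure a' b.
Proof. by have := bilin_l pure_bilinear b 1 a a'; rewrite !scale1r. Qed.

Lemma pureDr (a : A) (b b' : B) : pure a (b + b') = pure a b + pure a b'.
Proof. by have := bilin_r pure_bilinear a 1 b b'; rewrite !scale1r. Qed.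

Lemma pure0l (b : B) : pure (0 : A) b = 0.
Proof. by apply: (addrI (pure 0 b)); rewrite -pureDl !addr0. Qed.

Lemma pure0r (a : A) : pure a (0 : B) = 0.
Proof. by apply: (addrI (pure a 0)); rewrite -pureDr !addr0. Qed.

Lemma pureZl c (a : A) (b : B) : pure (c *: a) b = c *: pure a b.
Proof. by have := bilin_l pure_bilinear b c a 0; rewrite !addr0 pure0l addr0. Qed.

Lemma pureZr c (a : A) (b : B) : pure a (c *: b) = c *: pure a b.
Proof. by have := bilin_r pure_bilinear a c b 0; rewrite !addr0 pure0r addr0. Qed.

Lemma sum_pure_eq (s t : seq (A * B)) :
  \sum_(p <- s) pure p.1 p.2 = \sum_(p <- t) pure p.1 p.2 <-> tensor_eq s t.
Proof. by rewrite -!tclass_sum; apply: tclassP. Qed.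

End Space.

Section Algebra.
Variables A B : algType K.
Local Notation T := (tensor A B).

Definition fmul (s t : formal_tensor A B) : formal_tensor A B :=
  [seq (p.1 * r.1, p.2 * r.2) | p <- s, r <- t].

Definition tmul (s t : T) : T := tclass (fmul (repr s) (repr t)).

Lemma fmulE (V : lmodType K) (beta : A -> B -> V) s t :
  \sum_(p <- fmul s t) beta p.1 p.2 =
  \sum_(p <- s) \sum_(r <- t) beta (p.1 * r.1) (p.2 * r.2).
Proof. by rewrite /fmul big_allpairs_dep. Qed.

Lemma bilinear_mul (V : lmodType K) (beta : A -> B -> V) x y :
  bilinear_map beta ->
  bilinear_map (fun a b => beta (a * x) (b * y)) /\
  bilinear_map (fun a b => beta (x * a) (y * b)).
Proof.
move=> hb; split; split=> u c v w /=.
- by rewrite mulrDl -scalerAl; apply: (bilin_l hb).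
- by rewrite mulrDl -scalerAl; apply: (bilin_r hb).
- by rewrite mulrDr -scalerAr; apply: (bilin_l hb).
- by rewrite mulrDr -scalerAr; apply: (bilin_r hb).
Qed.

Lemma tclassM s t : tmul (tclass s) (tclass t) = tclass (fmul s t).
Proof.
apply/tclassP => V beta hb; rewrite !fmulE exchange_big /=.
under eq_bigr => r _.
  rewrite (trepr_eq s (proj1 (bilinear_mul r.1 r.2 hb))); over.
rewrite exchange_big /=; apply: eq_bigr => p _.
exact: (trepr_eq t (proj2 (bilinear_mul p.1 p.2 hb))).
Qed.

Lemma tmulA : associative tmul.
Proof.
elim/tclass_ind=> s; elim/tclass_ind=> t; elim/tclass_ind=> u.
rewrite !tclassM; apply/tclassP => V beta hb.
rewrite !fmulE [RHS]big_allpairs_dep; apply: eq_bigr => p _.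
rewrite [LHS]big_allpairs_dep; apply: eq_bigr => r _; apply: eq_bigr => z _ /=.
by rewrite !mulrA.
Qed.

Lemma tmul1l : left_id (pure 1 1) tmul.
Proof.
elim/tclass_ind=> s; rewrite tclassM; apply/tclassP => V beta hb.
by rewrite fmulE big_seq1; apply: eq_bigr => p _ /=; rewrite !mul1r.
Qed.

Lemma tmul1r : right_id (pure 1 1) tmul.
Proof.
elim/tclass_ind=> s; rewrite tclassM; apply/tclassP => V beta hb.
by rewrite fmulE; apply: eq_bigr => p _; rewrite big_seq1 /= !mulr1.
Qed.

Lemma tmulDl : left_distributive tmul +%R.
Proof.
elim/tclass_ind=> s; elim/tclass_ind=> t; elim/tclass_ind=> u.
rewrite /GRing.add/= !(tclassD, tclassM); apply/tclassP => V beta hb.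
by rewrite [RHS]big_cat /= !fmulE big_cat.
Qed.

Lemma tmulDr : right_distributive tmul +%R.
Proof.
elim/tclass_ind=> s; elim/tclass_ind=> t; elim/tclass_ind=> u.
rewrite /GRing.add/= !(tclassD, tclassM); apply/tclassP => V beta hb.
rewrite [RHS]big_cat /= !fmulE -big_split; apply: eq_bigr => p _ /=.
by rewrite big_cat.
Qed.

Lemma tone_neq0 : pure (1 : A) (1 : B) != 0.
Proof.
have [phi lphi phi1] := linear_form_neq0 (oner_neq0 A).
have [psi lpsi psi1] := linear_form_neq0 (oner_neq0 B).
have hb : bilinear_map (fun a b => phi a * psi b : K^o).
  split=> [b|a] c x y /=.
  - by rewrite lphi mulrDl scalerAl.
  - by rewrite lpsi mulrDr scalerAr.
apply/eqP => /tclassP/(_ _ _ hb)/eqP.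
by rewrite big_seq1 big_nil mulf_eq0 (negbTE phi1) (negbTE psi1).
Qed.

HB.instance Definition _ := GRing.Zmodule_isNzRing.Build T
  tmulA tmul1l tmul1r tmulDl tmulDr tone_neq0.

Lemma pureM (a a' : A) (b b' : B) :
  pure a b * pure a' b' = pure (a * a') (b * b').
Proof. by rewrite [LHS]tclassM. Qed.

Lemma tmul_scaleAl (c : K) (s t : T) : c *: (s * t) = (c *: s) * t.
Proof.
elim/tclass_ind: s => s; elim/tclass_ind: t => t.
rewrite /GRing.scale/= /GRing.mul/= !(tclassM, tclassZ).
apply/tclassP => V beta hb; rewrite fscaleE // !fmulE scaler_sumr big_map.
apply: eq_bigr => p _ /=; rewrite scaler_sumr; apply: eq_bigr => r _.
have := fscaleE c [:: p] (proj1 (bilinear_mul r.1 r.2 hb)).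
by rewrite !big_seq1.
Qed.

Lemma tmul_scaleAr (c : K) (s t : T) : c *: (s * t) = s * (c *: t).
Proof.
elim/tclass_ind: s => s; elim/tclass_ind: t => t.
rewrite /GRing.scale/= /GRing.mul/= !(tclassM, tclassZ).
apply/tclassP => V beta hb; rewrite fscaleE // !fmulE scaler_sumr.
apply: eq_bigr => p _ /=; rewrite scaler_sumr big_map; apply: eq_bigr => r _ /=.
have := fscaleE c [:: r] (proj2 (bilinear_mul p.1 p.2 hb)).
by rewrite !big_seq1.
Qed.

HB.instance Definition _ := GRing.Lmodule_isLalgebra.Build K T tmul_scaleAl.
HB.instance Definition _ := GRing.Lalgebra_isAlgebra.Build K T tmul_scaleAr.

End Algebra.
End Tensor.

(** [act h a] is [h(a)].  Only the comultiplication and the counit of the Hopf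
    algebra [H] enter the definition; the action of [h] on a product is computed
    from any decomposition of [Delta h] into pure tensors. *)
Record module_algebra (K : fieldType) (H A : algType K)
    (Delta : H -> tensor H H) (eps : H -> K^o) (act : H -> A -> A) : Prop :=
  ModuleAlgebra {
    act_linear : forall h, linear (act h);
    act_linearl : forall a, linear (act^~ a);
    act_one : forall a, act 1 a = a;
    act_mul : forall h g a, act (h * g) a = act h (act g a);
    act_prod : forall h (s : seq (H * H)),
      Delta h = \sum_(p <- s) pure p.1 p.2 ->
      forall a b, act h (a * b) = \sum_(p <- s) act p.1 a * act p.2 b;
    act_unit : forall h, act h 1 = eps h *: 1
  }.

Section QSerre.
Variables (F : fieldType) (q : F) (T : algType F).
Hypothesis q0 : q != 0.

Definition qserre (x1 x2 y : T) : T :=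
  x1 * x2 * y - (q + q^-1) *: (x1 * y * x2) + y * (x1 * x2).

Lemma qserreD1 x x' y z : qserre (x + x') y z = qserre x y z + qserre x' y z.
Proof.
rewrite /qserre !(mulrDl, mulrDr) scalerDr opprD.
by rewrite [RHS]addrACA; congr (_ + _); rewrite addrACA.
Qed.

Lemma qserreD2 x x' y z : qserre y (x + x') z = qserre y x z + qserre y x' z.
Proof.
rewrite /qserre !(mulrDl, mulrDr) scalerDr opprD.
by rewrite [RHS]addrACA; congr (_ + _); rewrite addrACA.
Qed.

Lemma qserreD3 x x' y z : qserre y z (x + x') = qserre y z x + qserre y z x'.
Proof.
rewrite /qserre !(mulrDl, mulrDr) scalerDr opprD.
by rewrite [RHS]addrACA; congr (_ + _); rewrite addrACA.
Qed.

Lemma qserre_skew (a b : T) : b * a = q^-1 *: (a * b) -> qserre a a b = 0.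
Proof.
move=> ba; have aba : a * b * a = q^-1 *: (a * a * b).
  by rewrite -mulrA ba -scalerAr mulrA.
rewrite /qserre mulrA ba -!scalerAl aba !scalerA -[a * a * b]scale1r !scalerA.
rewrite -scalerBl -scalerDl [X in X *: _](_ : _ = 0) ?scale0r //.
by field.
Qed.

Lemma qserre_skew' (a b : T) : b * a = q^-1 *: (a * b) -> qserre b b a = 0.
Proof.
move=> ba; have bab : b * a * b = q^-1 *: (a * b * b) by rewrite ba -scalerAl.
have bba : b * b * a = (q^-1 * q^-1) *: (a * b * b).
  by rewrite -mulrA ba -scalerAr mulrA bab scalerA.
rewrite /qserre bba bab !scalerA mulrA -[X in _ + X]scale1r.
rewrite -scalerBl -scalerDl [X in X *: _](_ : _ = 0) ?scale0r //.
by field.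
Qed.

Lemma qserreD (a b c d : T) :
    b * a = q ^+ 2 *: (a * b) -> b * c = q^-1 *: (c * b) ->
    d * a = q^-1 *: (a * d) ->
    qserre a a c = 0 -> qserre b b d = 0 ->
  qserre (a + b) (a + b) (c + d) = 0.
Proof.
move=> ba bc da aac bbd.
rewrite qserreD3 !qserreD1 !qserreD2 aac bbd (qserre_skew da) (qserre_skew' bc).
rewrite !(add0r, addr0).
have abc : a * b * c = q^-1 *: (a * c * b) by rewrite -mulrA bc -scalerAr mulrA.
have bac : b * a * c = q *: (a * c * b).
  by rewrite ba -scalerAl abc scalerA expr2 mulfK.
have cba : c * (b * a) = q ^+ 2 *: (c * a * b) by rewrite ba -scalerAr mulrA.
have bca : b * c * a = q *: (c * a * b).
  by rewrite bc -scalerAl -[c * b * a]mulrA cba scalerA expr2 mulKf.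
have bad : b * a * d = q ^+ 2 *: (a * b * d) by rewrite ba -scalerAl.
have bda : b * d * a = q *: (a * b * d).
  by rewrite -mulrA da -scalerAr mulrA bad scalerA expr2 mulKf.
have dab : d * (a * b) = q^-1 *: (a * d * b) by rewrite mulrA da -scalerAl.
have dba : d * (b * a) = q *: (a * d * b).
  by rewrite ba -scalerAr dab scalerA expr2 mulfK.
set r := q + q^-1.
have abE : qserre a b c + qserre b a c = 0.
  rewrite /qserre -/r abc bac cba bca mulrA !scalerA -scalerBl.
  rewrite -[_ - _ + _ *: _]addrA -scaleNr -scalerDl addrACA -scalerDl.
  rewrite -[X in _ + (X + _)]scale1r -scalerDl.
  rewrite [X in X *: _](_ : _ = 0) ?[X in _ + X *: _](_ : _ = 0).
  - by rewrite !scale0r addr0.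
  - by rewrite /r; field.
  - by rewrite /r; field.
have adE : qserre a b d + qserre b a d = 0.
  rewrite /qserre -/r dab bad bda dba !scalerA -scalerBl.
  rewrite -[_ - _ + _ *: _]addrA -scaleNr -scalerDl addrACA -scalerDl.
  rewrite -[X in X + _ *: (a * b * d)]scale1r -scalerDl.
  rewrite [X in X *: _](_ : _ = 0) ?[X in _ + X *: _](_ : _ = 0).
  - by rewrite !scale0r addr0.
  - by rewrite /r; field.
  - by rewrite /r; field.
by rewrite abE adE addr0.
Qed.
End QSerre.

Lemma pure_qserrel (F : fieldType) (q : F) (A B : algType F)
    (x y : A) (u v : B) : u * v = v * u ->
  qserre q (pure x u) (pure x u) (pure y v) = pure (qserre q x x y) (u * u * v).
Proof.
move=> uv; rewrite /qserre !pureM.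
have -> : u * v * u = u * u * v by rewrite -mulrA -uv mulrA.
have -> : v * (u * u) = u * u * v by rewrite mulrA -uv -mulrA -uv mulrA.
by rewrite -!scaleNr -pureZl -!pureDl.
Qed.

Lemma pure_qserrer (F : fieldType) (q : F) (A B : algType F)
    (x y : A) (u v : B) : x * y = y * x ->
  qserre q (pure x u) (pure x u) (pure y v) = pure (x * x * y) (qserre q u u v).
Proof.
move=> xy; rewrite /qserre !pureM.
have -> : x * y * x = x * x * y by rewrite -mulrA -xy mulrA.
have -> : y * (x * x) = x * x * y by rewrite mulrA -xy -mulrA -xy mulrA.
by rewrite -!scaleNr -pureZr -!pureDr.
Qed.

Inductive Uq_gen (m : nat) : Type :=
  Uq_E of 'I_m | Uq_F of 'I_m | Uq_K of 'I_m | Uq_Kinv of 'I_m.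

Definition cartan (m : nat) (i j : 'I_m) : int :=
  if i == j then 2
  else if (i.+1 == j :> nat) || (j.+1 == i :> nat) then -1 else 0.

Section Uq.
Variables (F : fieldType) (m : nat) (q : F).

Local Notation e i := (AGen (Uq_E i)).
Local Notation f i := (AGen (Uq_F i)).
Local Notation k i := (AGen (Uq_K i)).
Local Notation k' i := (AGen (Uq_Kinv i)).

Inductive Uq_relation : aterm F (Uq_gen m) -> aterm F (Uq_gen m) -> Prop :=
| Uq_KKinv i : Uq_relation (k i * k' i) 1
| Uq_KinvK i : Uq_relation (k' i * k i) 1
| Uq_KK i j : Uq_relation (k i * k j) (k j * k i)
| Uq_KE i j : Uq_relation (k i * e j * k' i) ((q ^ cartan i j) *: e j)
| Uq_KF i j : Uq_relation (k i * f j * k' i) ((q ^ (- cartan i j)) *: f j)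
| Uq_EF i j : Uq_relation (e i * f j - f j * e i)
    (if i == j then ((q - q^-1)^-1 *: (k i - k' i))%AT else 0%AT)
| Uq_EE i j : cartan i j = 0 -> Uq_relation (e i * e j) (e j * e i)
| Uq_FF i j : cartan i j = 0 -> Uq_relation (f i * f j) (f j * f i)
| Uq_SerreE i j : cartan i j = -1 ->
    Uq_relation (e i * e i * e j - (q + q^-1) *: (e i * e j * e i) + e j * (e i * e i)) 0
| Uq_SerreF i j : cartan i j = -1 ->
    Uq_relation (f i * f i * f j - (q + q^-1) *: (f i * f j * f i) + f j * (f i * f i)) 0.

Definition Uq_counit_gen (x : Uq_gen m) : F^o :=
  match x with
  | Uq_E _ | Uq_F _ => 0
  | Uq_K _ | Uq_Kinv _ => 1
  end.

Lemma Uq_counit_rel t u : Uq_relation t u ->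
  aeval Uq_counit_gen t = aeval Uq_counit_gen u.
Proof.
case=> [i|i|i j|i j|i j|i j|i j _|i j _|i j _|i j _] /=;
  rewrite ?(mulr0, mul0r, mulr1, mul1r, scale1r, scale0r, addr0) //.
case: (i == j) => /=; rewrite ?scale0r //.
by rewrite mulr1 scaleN1r addrN mulr0.
Qed.

Definition Uq_presentation : presentation F (Uq_gen m) :=
  Presentation (ex_intro _ Uq_counit_gen Uq_counit_rel).

Definition Uq := presented_algebra Uq_presentation.
HB.instance Definition _ := GRing.Algebra.on Uq.

Definition Ue (i : 'I_m) : Uq := pgen Uq_presentation (Uq_E i).
Definition Uf (i : 'I_m) : Uq := pgen Uq_presentation (Uq_F i).
Definition Uk (i : 'I_m) : Uq := pgen Uq_presentation (Uq_K i).
Definition Ukinv (i : 'I_m) : Uq := pgen Uq_presentation (Uq_Kinv i).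

Definition Uq_comul_gen (x : Uq_gen m) : tensor Uq Uq :=
  match x with
  | Uq_E i => pure 1 (Ue i) + pure (Ue i) (Uk i)
  | Uq_F i => pure (Ukinv i) (Uf i) + pure (Uf i) 1
  | Uq_K i => pure (Uk i) (Uk i)
  | Uq_Kinv i => pure (Ukinv i) (Ukinv i)
  end.

Definition Uq_comul : Uq -> tensor Uq Uq := plift Uq_comul_gen.
Definition Uq_counit : Uq -> F^o := plift Uq_counit_gen.

Lemma Uq_counitP : algebra_morphism Uq_counit.
Proof. exact/pliftP/Uq_counit_rel. Qed.

Lemma cartanC (i j : 'I_m) : cartan i j = cartan j i.
Proof. by rewrite /cartan eq_sym orbC. Qed.

Lemma Uq_relE t u : Uq_relation t u ->
  aeval (pgen Uq_presentation) t = aeval (pgen Uq_presentation) u.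
Proof. exact: (@pgen_rel _ _ Uq_presentation). Qed.

Lemma UkkV i : Uk i * Ukinv i = 1.
Proof. by have := Uq_relE (Uq_KKinv i); rewrite /= scale1r. Qed.

Lemma UkVk i : Ukinv i * Uk i = 1.
Proof. by have := Uq_relE (Uq_KinvK i); rewrite /= scale1r. Qed.

Lemma UkC i j : Uk i * Uk j = Uk j * Uk i.
Proof. exact: (Uq_relE (Uq_KK i j)). Qed.

Lemma Uke i j : Uk i * Ue j = q ^ cartan i j *: (Ue j * Uk i).
Proof.
have := Uq_relE (Uq_KE i j); rewrite /= -scalerAl mul1r => /(congr1 ( *%R^~ (Uk i))).
by rewrite -!mulrA [_ * pgen _ (Uq_K i)]UkVk mulr1 -scalerAl.
Qed.

Lemma Ukf i j : Uk i * Uf j = q ^ (- cartan i j) *: (Uf j * Uk i).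
Proof.
have := Uq_relE (Uq_KF i j); rewrite /= -scalerAl mul1r => /(congr1 ( *%R^~ (Uk i))).
by rewrite -!mulrA [_ * pgen _ (Uq_K i)]UkVk mulr1 -scalerAl.
Qed.

Lemma Uef i j : Ue i * Uf j - Uf j * Ue i =
  if i == j then (q - q^-1)^-1 *: (Uk i - Ukinv i) else 0.
Proof.
have := Uq_relE (Uq_EF i j).
case: (i == j); rewrite /= -!scalerAl ?mul1r scaleN1r => ->.
  by rewrite scaleN1r.
by rewrite scale0r.
Qed.

Lemma UeC i j : cartan i j = 0 -> Ue i * Ue j = Ue j * Ue i.
Proof. by move=> ij; apply: (Uq_relE (Uq_EE ij)). Qed.

Lemma UfC i j : cartan i j = 0 -> Uf i * Uf j = Uf j * Uf i.
Proof. by move=> ij; apply: (Uq_relE (Uq_FF ij)). Qed.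

Lemma Ue_serre i j : cartan i j = -1 -> qserre q (Ue i) (Ue i) (Ue j) = 0.
Proof.
move=> ij; have := Uq_relE (Uq_SerreE ij).
by rewrite /= scale0r -!scalerAl !mul1r scaleN1r.
Qed.

Lemma Uf_serre i j : cartan i j = -1 -> qserre q (Uf i) (Uf i) (Uf j) = 0.
Proof.
move=> ij; have := Uq_relE (Uq_SerreF ij).
by rewrite /= scale0r -!scalerAl !mul1r scaleN1r.
Qed.

Lemma UkVC i j : Ukinv i * Ukinv j = Ukinv j * Ukinv i.
Proof.
have YZ : (Ukinv j * Ukinv i) * (Uk i * Uk j) = 1.
  by rewrite mulrA -[_ * Uk i]mulrA UkVk mulr1 UkVk.
have ZX : (Uk i * Uk j) * (Ukinv i * Ukinv j) = 1.
  by rewrite UkC mulrA -[_ * Ukinv i]mulrA UkkV mulr1 UkkV.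
by rewrite -[LHS]mul1r -YZ -mulrA ZX mulr1.
Qed.

Section Comul.
Hypothesis q0 : q != 0.

Lemma Ukinv_skew i x (c : F) : c != 0 ->
  Uk i * x = c *: (x * Uk i) -> Ukinv i * x = c^-1 *: (x * Ukinv i).
Proof.
move=> c0 kx; apply: (scalerI c0); rewrite scalerA divff // scale1r.
have -> : x * Ukinv i = Ukinv i * (Uk i * x) * Ukinv i.
  by rewrite mulrA UkVk mul1r.
by rewrite kx -scalerAr -scalerAl mulrA -[_ * Uk i * _]mulrA UkkV mulr1.
Qed.

Lemma Ukinv_e i j : Ukinv i * Ue j = q ^ (- cartan i j) *: (Ue j * Ukinv i).
Proof. by rewrite -invr_expz; apply/Ukinv_skew/Uke/expfz_neq0. Qed.

Lemma Ukinv_f i j : Ukinv i * Uf j = q ^ cartan i j *: (Uf j * Ukinv i).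
Proof.
have := Ukinv_skew (expfz_neq0 (- cartan i j) q0) (Ukf i j).
by rewrite invr_expz opprK.
Qed.

Lemma cartan_ii (i : 'I_m) : cartan i i = 2.
Proof. by rewrite /cartan eqxx. Qed.

Lemma Uq_comul_EF i j :
  Uq_comul_gen (Uq_E i) * Uq_comul_gen (Uq_F j) -
    Uq_comul_gen (Uq_F j) * Uq_comul_gen (Uq_E i) =
  pure (Ukinv j) (Ue i * Uf j - Uf j * Ue i) +
    pure (Ue i * Uf j - Uf j * Ue i) (Uk i).
Proof.
rewrite /= !(mulrDl, mulrDr) !pureM !mul1r !mulr1.
rewrite Ukf Ukinv_e cartanC !(pureZl, pureZr).
rewrite -![- (_ * _)]scaleN1r pureDr pureDl pureZl pureZr !scaleN1r.
have H (V : zmodType) (a b c d x y : V) :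
    a + y + (x + c) - (b + x + (y + d)) = a - b + (c - d).
  rewrite [x + c]addrC [y + d]addrC (addrACA a) (addrACA b) [x + y]addrC.
  by rewrite opprD (addrACA (a + c)) subrr addr0 opprD addrACA.
exact: H.
Qed.

Lemma Uq_comul_rel t u : Uq_relation t u ->
  aeval Uq_comul_gen t = aeval Uq_comul_gen u.
Proof.
have kek i j : Uk i * Ue j * Ukinv i = q ^ cartan i j *: Ue j.
  by rewrite Uke -scalerAl -mulrA UkkV mulr1.
have kfk i j : Uk i * Uf j * Ukinv i = q ^ (- cartan i j) *: Uf j.
  by rewrite Ukf -scalerAl -mulrA UkkV mulr1.
have kkk i j : Uk i * Uk j * Ukinv i = Uk j.
  by rewrite UkC -mulrA UkkV mulr1.
have kvk i j : Uk i * Ukinv j * Ukinv i = Ukinv j.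
  by rewrite -mulrA UkVC mulrA UkkV mul1r.
case=> [i|i|i j|i j|i j|i j|i j ij|i j ij|i j ij|i j ij].
- by rewrite /= pureM UkkV scale1r.
- by rewrite /= pureM UkVk scale1r.
- by rewrite /= !pureM UkC.
- rewrite /= mulrDr mulrDl !pureM mulr1 UkkV kek kkk pureZl pureZr.
  by rewrite -scalerDr -scalerAl mul1r.
- rewrite /= mulrDr mulrDl !pureM mulr1 UkkV kfk kvk pureZl pureZr.
  by rewrite -scalerDr -scalerAl mul1r.
- have := Uq_comul_EF i j; rewrite Uef.
  case: (eqVneq i j) => [<-|_] /=; rewrite -!scalerAl !mul1r scaleN1r => ->.
    rewrite pureZl pureZr -scalerDr scaleN1r; congr (_ *: _).
    rewrite -!scaleN1r pureDl pureDr pureZl pureZr !scaleN1r.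
    by rewrite addrC addrA subrK.
  by rewrite pure0l pure0r addr0 scale0r.
- rewrite /= !(mulrDl, mulrDr) !pureM !mul1r !mulr1.
  rewrite !Uke -[cartan j i]cartanC ij expr0z !scale1r UeC // UkC.
  rewrite -!addrA; congr (_ + _); rewrite !addrA; congr (_ + _); exact: addrC.
- rewrite /= !(mulrDl, mulrDr) !pureM !mul1r !mulr1.
  rewrite !Ukinv_f -[cartan j i]cartanC ij expr0z !scale1r UfC // UkVC.
  rewrite -!addrA; congr (_ + _); rewrite !addrA; congr (_ + _); exact: addrC.
- rewrite /= scale0r -!scalerAl !mul1r scaleN1r.
  apply: qserreD => //.
  + by rewrite !pureM !mul1r !mulr1 Uke pureZr cartan_ii.
  + by rewrite !pureM !mul1r !mulr1 Uke pureZr ij.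
  + by rewrite !pureM !mul1r !mulr1 Uke pureZr cartanC ij.
  + by rewrite pure_qserrer // Ue_serre // pure0r.
  + by rewrite pure_qserrel ?Ue_serre ?pure0l //; apply: UkC.
- rewrite /= scale0r -!scalerAl !mul1r scaleN1r.
  rewrite ![pure (Ukinv _) _ + _]addrC; apply: qserreD => //.
  + by rewrite !pureM !mul1r !mulr1 Ukinv_f pureZl cartan_ii.
  + by rewrite !pureM !mul1r !mulr1 Ukinv_f pureZl ij.
  + by rewrite !pureM !mul1r !mulr1 Ukinv_f pureZl cartanC ij.
  + by rewrite pure_qserrel // Uf_serre // pure0l.
  + by rewrite pure_qserrer ?Uf_serre ?pure0r //; apply: UkVC.
Qed.

Lemma Uq_comulP : algebra_morphism Uq_comul.
Proof. exact/pliftP/Uq_comul_rel. Qed.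

Lemma Uq_comul_pgen x : Uq_comul (pgen Uq_presentation x) = Uq_comul_gen x.
Proof. exact/plift_gen/Uq_comul_rel. Qed.

End Comul.

Lemma Uq_counit_pgen x : Uq_counit (pgen Uq_presentation x) = Uq_counit_gen x.
Proof. exact/plift_gen/Uq_counit_rel. Qed.

End Uq.

Arguments Ue {F m q} i.
Arguments Uf {F m q} i.
Arguments Uk {F m q} i.
Arguments Ukinv {F m q} i.
Arguments Uq_comul {F m q} _.
Arguments Uq_counit {F m q} _.

Inductive qplane_gen : Type := qplane_X1 | qplane_X2.

Section QuantumPlane.
Variables (F : fieldType) (q : F).

Inductive qplane_relation : aterm F qplane_gen -> aterm F qplane_gen -> Prop :=
| qplane_X2X1 : qplane_relation
    (AGen qplane_X2 * AGen qplane_X1)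
    (q *: (AGen qplane_X1 * AGen qplane_X2)).

Lemma qplane_point : exists g : qplane_gen -> F^o,
  forall t u, qplane_relation t u -> aeval g t = aeval g u.
Proof. by exists (fun=> 0) => t u [] /=; rewrite !mulr0. Qed.

Definition qplane_presentation : presentation F qplane_gen :=
  Presentation qplane_point.

Definition qplane := presented_algebra qplane_presentation.
HB.instance Definition _ := GRing.Algebra.on qplane.

Definition x1 : qplane := pgen qplane_presentation qplane_X1.
Definition x2 : qplane := pgen qplane_presentation qplane_X2.

End QuantumPlane.

Arguments x1 {F q}.
Arguments x2 {F q}.

(** The formulas [k_i(x1) = +-x1], [k_i(x2) = +-x2], [e_i(xj) = f_i(xj) = 0]; the
    sign is a minus where [s1 i], resp. [s2 i], is [true]. *)
Definition sign_action (F : fieldType) (m : nat) (q : F)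
    (act : Uq m q -> qplane q -> qplane q) (s1 s2 : 'I_m -> bool) : Prop :=
  forall i : 'I_m,
    [/\ act (Uk i) x1 = (-1) ^+ s1 i *: x1, act (Uk i) x2 = (-1) ^+ s2 i *: x2,
        act (Ue i) x1 = 0 /\ act (Ue i) x2 = 0 &
        act (Uf i) x1 = 0 /\ act (Uf i) x2 = 0].

(* Main.v *)
Require Import Defs.
From HB Require Import structures.
From mathcomp Require Import all_boot all_order all_algebra.
From mathcomp Require Import boolp reals complex.
From mathcomp Require Import ring zify.

(** The idea is a count of dimensions on weights.  Write [A] for the quantum
    plane; it has the basis [x1 ^+ i * x2 ^+ j].

    Each [k_i] acts by an algebra automorphism of [A], and every automorphism of
    [A] is diagonal, because [q ^+ 2 != 1] ([automorphism_diagonal]): all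
    commutators lie in the ideal of the normal element [x1 * x2], hence an
    automorphism preserves [x1 * x2] up to a scalar, so the images of [x1] and
    [x2] are monomials with product [x1 * x2], and of the four ways to split it
    the relation [x2 * x1 = q *: (x1 * x2)] leaves one.  Let [k_j] multiply [x1]
    by [c1 j] and [x2] by [c2 j].

    If [e_i] does not kill both generators, a monomial of [e_i(x1)] or [e_i(x2)]
    gives a degree shift [(r, s)], a vector of [Z^2] with
    [c1 j ^ r * c2 j ^ s = q ^ a_ji] for all [j] ([weight_degree]).  An integral
    relation between such vectors gives, [q] not being a root of unity, the same
    relation between columns of the Cartan matrix ([weight_relation]).  Three
    consecutive columns are independent and [Z^2] has rank two, so among the
    first three [e_i], which exist as [m >= 3], one acts by zero
    ([exists_kills_e]).

    An [e_i] that acts by zero propagates.  The relation for [[e_i, f_i]] gives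
    [k_i ^ 2 = 1] on [A], so [c1 i] and [c2 i] are signs ([kills_e_signs]); then
    an operator on which [k_i] has the weight [q ^ b] with [b != 0] must kill
    the generators ([kills_weight]), in particular [f_i] and the [e_j] for the
    neighbours [j] of [i].  The Dynkin diagram being connected, all [e_i] and
    [f_i] vanish and all [k_i] act by signs ([action_signs]).

    Conversely the sign automorphisms commute and are involutions, so they give a
    representation of the quantum group in which the [e_i] and [f_i] are zero.
    The module-algebra axioms pass from generators to all elements
    ([module_algebra_gen]), and an action is determined by the action of the
    generators ([sign_action_unique]). *)

Set Implicit Arguments.
Unset Strict Implicit.
Unset Printing Implicit Defensive.

Import GRing.Theory.
Local Open Scope ring_scope.

(** * Linear maps and algebra morphisms *)

Section LinearFun.
Variables (K : pzRingType) (V W : lmodType K) (f : V -> W).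
Hypothesis lf : linear f.

Lemma linear_fun0 : f 0 = 0.
Proof. by have := lf (-1) 0 0; rewrite scaler0 addr0 scaleN1r addNr. Qed.

Lemma linear_funD : {morph f : x y / x + y}.
Proof. by move=> x y; have := lf 1 x y; rewrite !scale1r. Qed.

Lemma linear_funZ c : {morph f : x / c *: x}.
Proof. by move=> x; have := lf c x 0; rewrite linear_fun0 !addr0. Qed.

Lemma linear_funN : {morph f : x / - x}.
Proof. by move=> x; rewrite -scaleN1r linear_funZ scaleN1r. Qed.

Lemma linear_funB : {morph f : x y / x - y}.
Proof. by move=> x y; rewrite linear_funD linear_funN. Qed.

Lemma linear_fun_sum (I : Type) (r : seq I) (E : I -> V) :
  f (\sum_(i <- r) E i) = \sum_(i <- r) f (E i).
Proof. exact: (big_morph f linear_funD linear_fun0). Qed.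

End LinearFun.

Lemma algmor_comp (K : pzRingType) (A B C : algType K) (f : B -> C) (g : A -> B) :
  algebra_morphism f -> algebra_morphism g -> algebra_morphism (f \o g).
Proof.
move=> [lf f1 fM] [lg g1 gM]; split=> [k x y|/=|x y /=].
- by rewrite /= lg lf.
- by rewrite g1.
- by rewrite gM fM.
Qed.

(** * The algebra of linear endomorphisms *)


Section LinearEndomorphisms.
Variables (K : fieldType) (V : lmodType K) (v : V) (v_neq0 : v != 0).

(** The linear endomorphisms of [V], of any dimension, as an [algType], so that a
    presented algebra can be mapped into them.  An [algType] is nontrivial,
    whence the nonzero vector. *)
Definition lend of v != 0 := {f : V -> V | linear f}.
Local Notation L := (lend v_neq0).
HB.instance Definition _ := gen_eqMixin L.
HB.instance Definition _ := gen_choiceMixin L.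

Definition lend_fun (f : L) : V -> V := proj1_sig f.

Lemma lend_linear (f : L) : linear (lend_fun f).
Proof. exact: proj2_sig f. Qed.

Lemma lendP (f g : L) : lend_fun f =1 lend_fun g -> f = g.
Proof. by case: f g => f lf [g lg] fg; apply: eq_exist; apply: funext. Qed.

Definition mk_lend (f : V -> V) (lf : linear f) : L := exist _ f lf.

Fact lend_add_linear (f g : L) : linear (fun x => lend_fun f x + lend_fun g x).
Proof. by move=> c x y; rewrite !lend_linear scalerDr addrACA. Qed.

Fact lend_opp_linear (f : L) : linear (fun x => - lend_fun f x).
Proof. by move=> c x y; rewrite lend_linear opprD scalerN. Qed.

Fact lend_zero_linear : linear (fun _ : V => 0 : V).
Proof. by move=> c x y; rewrite scaler0 addr0. Qed.

Fact lend_one_linear : linear (@id V).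
Proof. by []. Qed.

Fact lend_mul_linear (f g : L) : linear (fun x => lend_fun f (lend_fun g x)).
Proof. by move=> c x y; rewrite !lend_linear. Qed.

Fact lend_scale_linear (c : K) (f : L) : linear (fun x => c *: lend_fun f x).
Proof. by move=> d x y; rewrite lend_linear scalerDr !scalerA mulrC. Qed.

Definition lend_add f g := mk_lend (lend_add_linear f g).
Definition lend_opp f := mk_lend (lend_opp_linear f).
Definition lend_zero := mk_lend lend_zero_linear.
Definition lend_one := mk_lend lend_one_linear.
Definition lend_mul f g := mk_lend (lend_mul_linear f g).
Definition lend_scale c f := mk_lend (lend_scale_linear c f).

Fact lend_addA : associative lend_add.
Proof. by move=> f g h; apply: lendP => x; apply: addrA. Qed.
Fact lend_addC : commutative lend_add.
Proof. by move=> f g; apply: lendP => x; apply: addrC. Qed.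
Fact lend_add0 : left_id lend_zero lend_add.
Proof. by move=> f; apply: lendP => x; apply: add0r. Qed.
Fact lend_addN : left_inverse lend_zero lend_opp lend_add.
Proof. by move=> f; apply: lendP => x; apply: addNr. Qed.

HB.instance Definition _ :=
  GRing.isZmodule.Build L lend_addA lend_addC lend_add0 lend_addN.

Fact lend_mulA : associative lend_mul.
Proof. by move=> f g h; apply: lendP. Qed.
Fact lend_mul1l : left_id lend_one lend_mul.
Proof. by move=> f; apply: lendP. Qed.
Fact lend_mul1r : right_id lend_one lend_mul.
Proof. by move=> f; apply: lendP. Qed.
Fact lend_mulDl : left_distributive lend_mul +%R.
Proof. by move=> f g h; apply: lendP. Qed.
Fact lend_mulDr : right_distributive lend_mul +%R.
Proof. by move=> f g h; apply: lendP => x; apply/linear_funD/lend_linear. Qed.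
Fact lend_one_neq0 : lend_one != 0.
Proof.
apply/eqP => /(congr1 (fun f => lend_fun f v)) /= vE.
by move: v_neq0; rewrite [v]vE eqxx.
Qed.

HB.instance Definition _ := GRing.Zmodule_isNzRing.Build L
  lend_mulA lend_mul1l lend_mul1r lend_mulDl lend_mulDr lend_one_neq0.

Fact lend_scaleA c d (f : L) : lend_scale c (lend_scale d f) = lend_scale (c * d) f.
Proof. by apply: lendP => x; apply: scalerA. Qed.
Fact lend_scale1 : left_id 1 lend_scale.
Proof. by move=> f; apply: lendP => x; apply: scale1r. Qed.
Fact lend_scaleDr : right_distributive lend_scale +%R.
Proof. by move=> c f g; apply: lendP => x; apply: scalerDr. Qed.
Fact lend_scaleDl (f : L) : {morph lend_scale^~ f : c d / c + d}.
Proof. by move=> c d; apply: lendP => x; apply: scalerDl. Qed.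

HB.instance Definition _ := GRing.Zmodule_isLmodule.Build K L
  lend_scaleA lend_scale1 lend_scaleDr lend_scaleDl.

Fact lend_scaleAl (c : K) (f g : L) : c *: (f * g) = (c *: f) * g.
Proof. exact: lendP. Qed.
Fact lend_scaleAr (c : K) (f g : L) : c *: (f * g) = f * (c *: g).
Proof. by apply: lendP => x; rewrite [RHS]linear_funZ //; apply: lend_linear. Qed.

HB.instance Definition _ := GRing.Lmodule_isLalgebra.Build K L lend_scaleAl.
HB.instance Definition _ := GRing.Lalgebra_isAlgebra.Build K L lend_scaleAr.

Lemma lend_funD (f g : L) x : lend_fun (f + g) x = lend_fun f x + lend_fun g x.
Proof. by []. Qed.
Lemma lend_funM (f g : L) x : lend_fun (f * g) x = lend_fun f (lend_fun g x).
Proof. by []. Qed.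
Lemma lend_funZ c (f : L) x : lend_fun (c *: f) x = c *: lend_fun f x.
Proof. by []. Qed.
Lemma lend_fun1 x : lend_fun (1 : L) x = x.
Proof. by []. Qed.

End LinearEndomorphisms.

(** * Presented algebras *)

Section PresentedAlgebra.
Variables (K : fieldType) (X : Type) (rel : presentation K X).
Local Notation P := (presented_algebra rel).

Lemma presented_ind (Q : P -> Prop) :
  (forall x, Q (pgen rel x)) -> (forall c, Q (c *: 1)) ->
  (forall a b, Q a -> Q b -> Q (a + b)) -> (forall a b, Q a -> Q b -> Q (a * b)) ->
  forall a, Q a.
Proof.
move=> Qg Qc QD QM; elim/pclass_ind => t; rewrite -aeval_pgen.
by elim: t => [x|c|t IHt u IHu|t IHt u IHu] /=; auto.
Qed.

Lemma presented_morph_ext (A : algType K) (f g : P -> A) :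
  algebra_morphism f -> algebra_morphism g ->
  (forall x, f (pgen rel x) = g (pgen rel x)) -> f =1 g.
Proof.
move=> [lf f1 fM] [lg g1 gM] fg; elim/presented_ind => [//|c|a b ea eb|a b ea eb].
- by rewrite (linear_funZ lf) (linear_funZ lg) f1 g1.
- by rewrite (linear_funD lf) (linear_funD lg) ea eb.
- by rewrite fM gM ea eb.
Qed.

End PresentedAlgebra.

(** * The monomial basis of the quantum plane *)

Section Basis.
Variables (F : fieldType) (q : F).
Local Notation A := (qplane q).

Lemma x2x1 : x2 * x1 = q *: (x1 * x2) :> A.
Proof.
have := pgen_rel (rel := qplane_presentation q) (qplane_X2X1 q).
by rewrite /= -scalerAl mul1r.
Qed.

(** Polynomials in [x2] with coefficients polynomials in [x1]: the underlying
    space of the regular representation of the quantum plane in its monomial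
    basis.  The alias carries the scalars [F] in place of [{poly F}]. *)
Definition bipoly := {poly {poly F}}.
HB.instance Definition _ := GRing.Zmodule.on bipoly.

Definition bipoly_scale (c : F) (v : bipoly) : bipoly := c%:P *: (v : {poly {poly F}}).

Fact bipoly_scaleA c d v : bipoly_scale c (bipoly_scale d v) = bipoly_scale (c * d) v.
Proof. by rewrite /bipoly_scale scalerA polyCM. Qed.
Fact bipoly_scale1 : left_id 1 bipoly_scale.
Proof. by move=> v; rewrite /bipoly_scale scale1r. Qed.
Fact bipoly_scaleDr : right_distributive bipoly_scale +%R.
Proof. by move=> c v w; apply: scalerDr. Qed.
Fact bipoly_scaleDl v : {morph bipoly_scale^~ v : c d / c + d}.
Proof. by move=> c d; rewrite /bipoly_scale polyCD scalerDl. Qed.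

HB.instance Definition _ := GRing.Zmodule_isLmodule.Build F bipoly
  bipoly_scaleA bipoly_scale1 bipoly_scaleDr bipoly_scaleDl.

Definition coef2 (v : bipoly) (i j : nat) : F := (v : {poly {poly F}})`_j`_i.

Lemma coef2Z c v i j : coef2 (c *: v) i j = c * coef2 v i j.
Proof. by rewrite /coef2 /GRing.scale/= coefZ coefCM. Qed.

Lemma coef2D v w i j : coef2 (v + w) i j = coef2 v i j + coef2 w i j.
Proof. by rewrite /coef2 !coefD. Qed.

Lemma coef2P (v w : bipoly) : (forall i j, coef2 v i j = coef2 w i j) -> v = w.
Proof. by move=> vw; apply/polyP => j; apply/polyP => i; apply: vw. Qed.

Definition dilate (p : {poly F}) : {poly F} := p \Po (q *: 'X).

Lemma coef_dilate p i : (dilate p)`_i = q ^+ i * p`_i.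
Proof.
rewrite /dilate comp_polyE coef_sum.
under eq_bigr => k _ do rewrite exprZn coefZ coefZ coefXn.
have [ip|ip] := ltnP i (size p); last first.
  rewrite nth_default // mulr0 big1 // => k _.
  by rewrite [i == k]gtn_eqF ?mulr0 // (leq_trans _ ip).
rewrite (bigD1 (Ordinal ip)) //= eqxx mulr1 mulrC big1 ?addr0 // => k ki.
suff -> : (i == k) = false by rewrite !mulr0.
by apply/eqP => ik; case/eqP: ki; apply/val_inj.
Qed.

(** [shift1] and [shift2] are the left multiplications by [x1] and by [x2] on the
    monomial basis: moving [x2] to the right of [x1 ^+ i] costs [q ^+ i], which
    is the substitution of [q *: 'X] for [x1]. *)
Definition shift1 (v : bipoly) : bipoly := 'X *: (v : {poly {poly F}}).
Definition shift2 (v : bipoly) : bipoly := map_poly dilate v * 'X.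

Lemma coef2_shift1 v i j :
  coef2 (shift1 v) i j = if i is i'.+1 then coef2 v i' j else 0.
Proof. by rewrite /coef2 coefZ coefXM; case: i. Qed.

Lemma dilate0 : dilate 0 = 0. Proof. exact: comp_poly0. Qed.

Lemma coef2_shift2 v i j :
  coef2 (shift2 v) i j = if j is j'.+1 then q ^+ i * coef2 v i j' else 0.
Proof.
rewrite /coef2 coefMX; case: j => [|j] /=; first by rewrite coef0.
by rewrite coef_map_id0 ?dilate0 // coef_dilate.
Qed.

Fact shift1_linear : linear shift1.
Proof.
move=> c v w; apply: coef2P => i j.
rewrite coef2D coef2Z !coef2_shift1; case: i => [|i]; first by rewrite mulr0 addr0.
by rewrite coef2D coef2Z.
Qed.

Fact shift2_linear : linear shift2.
Proof.
move=> c v w; apply: coef2P => i j.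
rewrite coef2D coef2Z !coef2_shift2; case: j => [|j]; first by rewrite mulr0 addr0.
by rewrite coef2D coef2Z; ring.
Qed.

Fact bipoly1_neq0 : (1 : {poly {poly F}}) != 0 :> bipoly.
Proof. exact: oner_neq0. Qed.

Definition qplane_rep_gen (x : qplane_gen) : lend bipoly1_neq0 :=
  match x with
  | qplane_X1 => mk_lend bipoly1_neq0 shift1_linear
  | qplane_X2 => mk_lend bipoly1_neq0 shift2_linear
  end.

Lemma qplane_rep_rel t u : qplane_presentation q t u ->
  aeval qplane_rep_gen t = aeval qplane_rep_gen u.
Proof.
case=> /=; apply: lendP => v; rewrite -scalerAl mul1r lend_funZ !lend_funM /=.
apply: coef2P => i j; rewrite coef2Z !(coef2_shift1, coef2_shift2).
case: i j => [|i] [|j]; rewrite ?(coef2_shift1, coef2_shift2) ?mulr0 //.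
by rewrite exprS mulrA.
Qed.

Definition qplane_rep : A -> lend bipoly1_neq0 := plift qplane_rep_gen.

Lemma qplane_repP : algebra_morphism qplane_rep.
Proof. exact/pliftP/qplane_rep_rel. Qed.

Definition qact (u : A) : bipoly -> bipoly := lend_fun (qplane_rep u).

Lemma qact_x1 v : qact x1 v = shift1 v.
Proof. by rewrite /qact /qplane_rep plift_gen //; apply: qplane_rep_rel. Qed.
Lemma qact_x2 v : qact x2 v = shift2 v.
Proof. by rewrite /qact /qplane_rep plift_gen //; apply: qplane_rep_rel. Qed.
Lemma qactM u w v : qact (u * w) v = qact u (qact w v).
Proof. by rewrite /qact (algmor_mul qplane_repP). Qed.
Lemma qactD u w v : qact (u + w) v = qact u v + qact w v.
Proof. by rewrite /qact (linear_funD (algmor_linear qplane_repP)). Qed.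
Lemma qactZ c u v : qact (c *: u) v = c *: qact u v.
Proof. by rewrite /qact (linear_funZ (algmor_linear qplane_repP)). Qed.
Lemma qact1 v : qact 1 v = v.
Proof. by rewrite /qact (algmor_one qplane_repP). Qed.

(** The coordinates of [u]: the regular representation evaluated at the unit. *)
Definition symbol (u : A) : bipoly := qact u (1 : {poly {poly F}}).
Definition qcoef (u : A) : nat -> nat -> F := coef2 (symbol u).

Definition poly_x1 (p : {poly F}) : A := horner_alg x1 p.
(** The substitution of the actual [x1] and [x2].  Horner evaluation puts the
    coefficients, polynomials in [x1], to the left of the powers of [x2], which
    is the order of the basis. *)
Definition unsymbol (v : bipoly) : A := (map_poly poly_x1 v).[x2].

Lemma poly_x1D : {morph poly_x1 : p r / p + r}. Proof. exact: rmorphD. Qed.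
Lemma poly_x1M : {morph poly_x1 : p r / p * r}. Proof. exact: rmorphM. Qed.
Lemma poly_x1C c : poly_x1 c%:P = c *: 1. Proof. exact: horner_algC. Qed.
Lemma poly_x1X : poly_x1 'X = x1. Proof. exact: horner_algX. Qed.
Lemma poly_x1_0 : poly_x1 0 = 0. Proof. exact: rmorph0. Qed.

Lemma x2_poly_x1 p : x2 * poly_x1 p = poly_x1 (dilate p) * x2.
Proof.
elim/poly_ind: p => [|p c IHp]; first by rewrite dilate0 poly_x1_0 mulr0 mul0r.
rewrite /dilate comp_poly_MXaddC -/(dilate p) -mul_polyC.
rewrite !(poly_x1D, poly_x1M, poly_x1C, poly_x1X) mulrDr mulrDl.
congr (_ + _); last by rewrite -scalerAl -scalerAr mulr1 mul1r.
by rewrite mulrA IHp -mulrA x2x1 -[q *: 1 * _]scalerAl mul1r -!scalerAr -scalerAl mulrA.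
Qed.

Lemma map_poly_x1D v w :
  map_poly poly_x1 (v + w) = map_poly poly_x1 v + map_poly poly_x1 w.
Proof. exact: (rmorphD (map_poly (horner_alg (x1 : A)))). Qed.
Lemma map_poly_x1Z p v : map_poly poly_x1 (p *: v) = poly_x1 p *: map_poly poly_x1 v.
Proof. exact: (map_polyZ (horner_alg (x1 : A))). Qed.
Lemma map_poly_x1MX v : map_poly poly_x1 (v * 'X) = map_poly poly_x1 v * 'X.
Proof.
have /= -> := rmorphM (map_poly (horner_alg (x1 : A))) v 'X.
by rewrite map_polyX.
Qed.
Lemma map_poly_x1C p : map_poly poly_x1 p%:P = (poly_x1 p)%:P.
Proof. exact: (map_polyC (horner_alg (x1 : A))). Qed.

Lemma unsymbolD : {morph unsymbol : v w / v + w}.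
Proof. by move=> v w; rewrite /unsymbol map_poly_x1D hornerD. Qed.

Lemma unsymbolZ c v : unsymbol (c *: v) = c *: unsymbol v.
Proof.
rewrite /unsymbol /GRing.scale/= /bipoly_scale map_poly_x1Z hornerZ poly_x1C.
by rewrite -scalerAl mul1r.
Qed.

Lemma unsymbol_shift1 v : unsymbol (shift1 v) = x1 * unsymbol v.
Proof. by rewrite /unsymbol map_poly_x1Z hornerZ poly_x1X. Qed.

Lemma unsymbol_shift2 v : unsymbol (shift2 v) = x2 * unsymbol v.
Proof.
rewrite /unsymbol /shift2 map_poly_x1MX hornerMX.
elim/poly_ind: v => [|v p IHv]; first by rewrite !(map_poly0, horner0) mulr0 mul0r.
have -> : map_poly dilate (v * 'X + p%:P) = map_poly dilate v * 'X + (dilate p)%:P.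
  by rewrite /dilate rmorphD rmorphM /= map_polyX map_polyC.
rewrite !(map_poly_x1D, map_poly_x1MX, map_poly_x1C) !hornerMXaddC.
rewrite mulrDl mulrDr mulrA -IHv; congr (_ + _); exact/esym/x2_poly_x1.
Qed.

Lemma unsymbol_qact u v : unsymbol (qact u v) = u * unsymbol v.
Proof.
elim/presented_ind: u v => [[] v|c v|a b IHa IHb v|a b IHa IHb v].
- by rewrite qact_x1 unsymbol_shift1.
- by rewrite qact_x2 unsymbol_shift2.
- by rewrite qactZ qact1 unsymbolZ -scalerAl mul1r.
- by rewrite qactD unsymbolD IHa IHb mulrDl.
- by rewrite qactM IHa IHb mulrA.
Qed.

(** That the monomials span: [unsymbol] intertwines the representation with left
    multiplication, so it sends [symbol u], the image of 1 under [u], back to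
    [u * 1].  Their independence is [qcoef_monomial]. *)
Lemma symbolK u : unsymbol (symbol u) = u.
Proof.
rewrite unsymbol_qact /unsymbol.
by rewrite -polyC1 map_poly_x1C -polyC1 poly_x1C scale1r hornerC mulr1.
Qed.

Lemma qcoefP u w : (forall i j, qcoef u i j = qcoef w i j) -> u = w.
Proof. by move=> uw; rewrite -[u]symbolK -[w]symbolK; congr unsymbol; apply: coef2P. Qed.

Lemma unsymbolE (v : bipoly) : unsymbol v =
  \sum_(j < size (v : {poly {poly F}})) \sum_(i < size (v : {poly {poly F}})`_j)
    coef2 v i j *: (x1 ^+ i * x2 ^+ j).
Proof.
rewrite /unsymbol (horner_coef_wide _ (size_poly _ _)).
apply: eq_bigr => j _; rewrite coef_map_id0 ?poly_x1_0 // /poly_x1.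
rewrite /horner_alg /horner_morph (horner_coef_wide _ (size_poly _ _)) mulr_suml.
apply: eq_bigr => i _; rewrite coef_map_id0 /= ?scale0r //.
by rewrite -[_ * x1 ^+ i]scalerAl mul1r -scalerAl.
Qed.

Lemma qcoefM_monomial i j u n m : qcoef (x1 ^+ i * x2 ^+ j * u) n m =
  if (i <= n)%N && (j <= m)%N then q ^+ (j * (n - i)) * qcoef u (n - i) (m - j) else 0.
Proof.
rewrite /qcoef /symbol qactM.
set v := qact u _; clearbody v.
rewrite qactM; elim: i n => [|i IHi] n.
  rewrite expr0 qact1 subn0 /=.
  elim: j m => [|j IHj] m; first by rewrite expr0 qact1 mul0n expr0 mul1r subn0.
  rewrite exprS qactM qact_x2 coef2_shift2; case: m => [//|m].
  rewrite IHj ltnS subSS mulSn exprD; case: (j <= m)%N; last by rewrite mulr0.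
  by rewrite mulrA.
rewrite exprS qactM qact_x1 coef2_shift1; case: n => [//|n].
by rewrite IHi ltnS subSS.
Qed.

Lemma qcoefD u w i j : qcoef (u + w) i j = qcoef u i j + qcoef w i j.
Proof. by rewrite /qcoef /symbol qactD coef2D. Qed.
Lemma qcoefZ c u i j : qcoef (c *: u) i j = c * qcoef u i j.
Proof. by rewrite /qcoef /symbol qactZ coef2Z. Qed.
Lemma qcoef_linear i j : linear (fun u => qcoef u i j : F^o).
Proof. by move=> c u w; rewrite qcoefD qcoefZ. Qed.

Lemma qcoef1 i j : qcoef 1 i j = ((i == 0%N) && (j == 0%N))%:R.
Proof.
rewrite /qcoef /symbol qact1 /coef2 coef1; case: (j == 0%N); last by rewrite andbF coef0.
by rewrite coef1 andbT.
Qed.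

Lemma qcoef_monomial i j n m : qcoef (x1 ^+ i * x2 ^+ j) n m = ((n == i) && (m == j))%:R.
Proof.
rewrite -[_ * _]mulr1 qcoefM_monomial qcoef1 !subn_eq0.
rewrite [n == i]eqn_leq [m == j]eqn_leq.
case: (leqP i n); case: (leqP j m) => //= _ _; rewrite ?andbF // !andbT.
rewrite -!subn_eq0; case: eqP => [->|_]; first by rewrite muln0 mul1r.
by rewrite mulr0.
Qed.

Lemma qplane_expand u :
  u = \sum_(j < size (symbol u : {poly {poly F}}))
      \sum_(i < size (symbol u : {poly {poly F}})`_j)
        qcoef u i j *: (x1 ^+ i * x2 ^+ j).
Proof. by rewrite -[LHS]symbolK unsymbolE. Qed.

Lemma qcoef0 i j : qcoef (0 : A) i j = 0.
Proof. by rewrite -[0](scale0r 1) qcoefZ mul0r. Qed.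

Lemma linear_qplane_expand (W : lmodType F) (f : A -> W) u : linear f ->
  f u = \sum_(j < size (symbol u : {poly {poly F}}))
        \sum_(i < size (symbol u : {poly {poly F}})`_j)
          qcoef u i j *: f (x1 ^+ i * x2 ^+ j).
Proof.
move=> lf; rewrite {1}(qplane_expand u) (linear_fun_sum lf); apply: eq_bigr => j _.
by rewrite (linear_fun_sum lf); apply: eq_bigr => i _; apply: linear_funZ.
Qed.

Lemma x1x2_neq0 : x1 * x2 != 0 :> A.
Proof.
apply/eqP => /(congr1 (fun u => qcoef u 1 1)) /eqP.
have -> : x1 * x2 = x1 ^+ 1 * x2 ^+ 1 :> A by [].
by rewrite qcoef_monomial qcoef0 oner_eq0.
Qed.

End Basis.

(** * Automorphisms of the quantum plane *)

Section Automorphisms.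
Variables (F : fieldType) (q : F).
Hypothesis q_neq0 : q != 0.
Local Notation A := (qplane q).
Implicit Types (u w z : A) (a b : nat * nat).

(** The exponent of [x2] is compared first, to match the nesting of [bipoly]. *)
Definition lex (a b : nat * nat) : bool :=
  (a.2 < b.2)%N || (a.2 == b.2) && (a.1 < b.1)%N.

Local Notation lex_gt := (fun a b => lex b a).

(** For [r := lex] the exponent [a] is that of the leading monomial of [u], for the
    opposite order that of the trailing one. *)
Definition extremal (r : rel (nat * nat)) (u : A) (a : nat * nat) : Prop :=
  qcoef u a.1 a.2 != 0 /\ forall b, r a b -> qcoef u b.1 b.2 = 0.

(** The part of compatibility with addition that makes extremal monomials
    multiplicative: when [a + b] is split in another way, one of the two parts
    goes beyond [a] or beyond [b]. *)
Definition separating (r : rel (nat * nat)) : Prop := forall a b a' b',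
  (a.1 + b.1 = a'.1 + b'.1)%N -> (a.2 + b.2 = a'.2 + b'.2)%N -> a <> a' ->
  r a a' || r b b'.

Lemma separating_lex : separating lex.
Proof.
move=> [a1 a2] [b1 b2] [c1 c2] [d1 d2] /= e1 e2 ac; rewrite /lex /=.
have {}ac : ~~ ((a1 == c1) && (a2 == c2)).
  by apply/negP => /andP[/eqP ? /eqP ?]; apply: ac; congr pair.
lia.
Qed.

Lemma separating_lex_gt : separating lex_gt.
Proof. by move=> a b a' b' e1 e2 /nesym; apply: separating_lex. Qed.

Lemma qcoefM u w n m : qcoef (u * w) n m =
  \sum_(j < size (symbol u : {poly {poly F}}))
    \sum_(i < size (symbol u : {poly {poly F}})`_j)
      qcoef u i j * qcoef (x1 ^+ i * x2 ^+ j * w) n m.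
Proof.
apply: (linear_qplane_expand (f := fun u => qcoef (u * w) n m : F^o)).
by move=> c u' w'; rewrite mulrDl -scalerAl qcoef_linear.
Qed.

(** Only one pair of monomials of [u] and [w] contributes to the monomial [a + b]:
    any other pair has a factor beyond the extremal one. *)
Lemma extremalM r u w a b : separating r -> extremal r u a -> extremal r w b ->
  qcoef (u * w) (a.1 + b.1) (a.2 + b.2) =
    q ^+ (a.2 * b.1) * (qcoef u a.1 a.2 * qcoef w b.1 b.2).
Proof.
move=> hr [ua ua0] [wb wb0]; rewrite qcoefM.
have a2 : (a.2 < size (symbol u : {poly {poly F}}))%N.
  by rewrite ltnNge; apply: contra ua => le; rewrite /qcoef /coef2 (nth_default _ le) coef0.
have a1 : (a.1 < size ((symbol u : {poly {poly F}})`_a.2)%R)%N.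
  by rewrite ltnNge; apply: contra ua => le; rewrite /qcoef /coef2 (nth_default _ le).
have z i j : (i, j) <> a ->
    qcoef u i j * qcoef (x1 ^+ i * x2 ^+ j * w) (a.1 + b.1) (a.2 + b.2) = 0.
  move=> ija; rewrite qcoefM_monomial; case: ifP; last by rewrite mulr0.
  case/andP=> hi hj.
  have := hr a b (i, j) (a.1 + b.1 - i, a.2 + b.2 - j)%N.
  rewrite /= !subnKC // => /(_ erefl erefl (nesym ija)).
  by case/orP => [/ua0|/wb0] /= ->; rewrite ?mul0r ?mulr0.
rewrite (bigD1 (Ordinal a2)) //= [X in _ + X]big1 => [|j ja]; last first.
  apply: big1 => i _; apply: z => ija; case/eqP: ja.
  exact/val_inj/(congr1 snd ija).
rewrite addr0 (bigD1 (Ordinal a1)) //= big1 => [|i ia]; last first.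
  by apply: z => ija; case/eqP: ia; apply/val_inj/(congr1 fst ija).
by rewrite addr0 qcoefM_monomial !leq_addr /= !addKn; ring.
Qed.

Lemma symbol_neq0 u : u != 0 -> symbol u != 0.
Proof.
by apply: contra => /eqP su; apply/eqP/qcoefP => i j; rewrite qcoef0 /qcoef su /coef2 !coef0.
Qed.

Lemma extremal_lex u : u != 0 -> exists a, extremal lex u a.
Proof.
move=> /symbol_neq0 u0; pose v : {poly {poly F}} := symbol u.
have u1 : v`_(size v).-1 != 0 by rewrite -lead_coefE lead_coef_eq0.
exists ((size v`_(size v).-1).-1, (size v).-1); split => /=.
  by rewrite /qcoef /coef2 -/v -lead_coefE lead_coef_eq0.
move=> [b1 b2]; rewrite /lex /= => /orP[lt|/andP[/eqP <- lt]]; rewrite /qcoef /coef2 -/v.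
  by rewrite (nth_default _ (leq_trans (leqSpred _) lt)) coef0.
by rewrite (nth_default _ (leq_trans (leqSpred _) lt)).
Qed.

Lemma extremal_lex_gt u : u != 0 -> exists a, extremal lex_gt u a.
Proof.
move=> /symbol_neq0 u0; pose v : {poly {poly F}} := symbol u.
have u1 : exists j, v`_j != 0 by exists (size v).-1; rewrite -lead_coefE lead_coef_eq0.
case: (ex_minnP u1) => j vj minj.
have u2 : exists i, v`_j`_i != 0 by exists (size v`_j).-1; rewrite -lead_coefE lead_coef_eq0.
case: (ex_minnP u2) => i vij mini.
exists (i, j); split => //= -[b1 b2]; rewrite /lex /= /qcoef /coef2 -/v.
case/orP => [lt|/andP[/eqP -> lt]].
  have [->|/minj] := eqVneq v`_b2 0; first by rewrite coef0.
  by rewrite leqNgt lt.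
by have [//|/mini] := eqVneq v`_j`_b1 0; rewrite leqNgt lt.
Qed.

Lemma x1x2_normal u : exists u', u * (x1 * x2) = x1 * x2 * u'.
Proof.
elim/presented_ind: u => [[]|c|a b [a' ea] [b' eb]|a b [a' ea] [b' eb]].
- exists (q^-1 *: x1); rewrite -scalerAr -[_ * _ * x1]mulrA x2x1 -scalerAr scalerA.
  by rewrite mulVf ?scale1r.
- by exists (q *: x2); rewrite -scalerAr mulrA [_ * x1]x2x1 -scalerAl.
- by exists (c *: 1); rewrite -scalerAl -scalerAr mulr1 mul1r.
- by exists (a' + b'); rewrite mulrDl mulrDr ea eb.
- by exists (a' * b'); rewrite -[a * b * _]mulrA eb [a * _]mulrA ea -!mulrA.
Qed.

Definition x1x2_ideal u := exists z, u = x1 * x2 * z.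

Lemma commutator_ideal_gen w :
  (forall x, x1x2_ideal (pgen (qplane_presentation q) x * w - w * pgen _ x)) ->
  forall u, x1x2_ideal (u * w - w * u).
Proof.
move=> gen; elim/presented_ind => [//|c|a b [z ea] [y eb]|a b [z ea] [y eb]].
- by exists 0; rewrite -scalerAl -scalerAr mulr1 mul1r subrr mulr0.
- by exists (z + y); rewrite mulrDl mulrDr opprD addrACA ea eb mulrDr.
have [a' na] := x1x2_normal a; exists (a' * y + z * b).
transitivity (a * (b * w - w * b) + (a * w - w * a) * b).
  by rewrite mulrBr mulrBl !mulrA addrA subrK.
rewrite ea eb mulrDr; congr (_ + _); last by rewrite mulrA.
by rewrite [LHS]mulrA na [RHS]mulrA.
Qed.

Lemma x1x2_idealN u : x1x2_ideal u -> x1x2_ideal (- u).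
Proof. by case=> z ->; exists (- z); rewrite mulrN. Qed.

(** The quotient by the normal element [x1 * x2] is commutative, since its two
    generators commute: [x2 * x1 - x1 * x2 = (q - 1) *: (x1 * x2)]. *)
Lemma commutator_ideal u w : x1x2_ideal (u * w - w * u).
Proof.
have c0 : x1x2_ideal 0 by exists 0; rewrite mulr0.
have c21 : x1x2_ideal (x2 * x1 - x1 * x2).
  by exists ((q - 1) *: 1); rewrite x2x1 -scalerAr mulr1 scalerBl scale1r.
move: u; apply: commutator_ideal_gen => x; rewrite -opprB; apply: x1x2_idealN.
move: w; apply: commutator_ideal_gen; case: x => -[] //.
- by rewrite subrr.
- by rewrite -opprB; apply: x1x2_idealN.
- by rewrite subrr.
Qed.

(** As [x1 * x2] is, up to the factor [q - 1], the commutator of [x2] and [x1], its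
    image is a commutator too. *)
Lemma algmor_x1x2 (phi : A -> A) : q != 1 -> algebra_morphism phi ->
  x1x2_ideal (phi (x1 * x2)).
Proof.
move=> q1 [lphi phi1 phiM]; have [z ez] := commutator_ideal (phi x2) (phi x1).
exists ((q - 1)^-1 *: z); rewrite -scalerAr -ez -!phiM x2x1 (linear_funZ lphi).
by rewrite -{3}[phi _]scale1r -scalerBl scalerA mulVf ?scale1r // subr_eq0.
Qed.

Lemma qcoef_x1x2M u i j : qcoef (x1 * x2 * u) i.+1 j.+1 = q ^+ i * qcoef u i j.
Proof.
have -> : x1 * x2 = x1 ^+ 1 * x2 ^+ 1 :> A by [].
by rewrite qcoefM_monomial /= !subn1 mul1n.
Qed.

Lemma qcoef_x1x2 i j : qcoef (x1 * x2 : A) i j = ((i == 1%N) && (j == 1%N))%:R.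
Proof. exact: (qcoef_monomial q 1 1). Qed.

(** With [phi (x1 * x2) = x1 * x2 * z] and [psi (x1 * x2) = x1 * x2 * y] one gets
    [x1 * x2 = x1 * x2 * (z * phi y)]; comparing leading monomials, that of [z] is
    the smallest one, so [z] is a scalar. *)
Lemma qcoef_automorphism_x1x2 (phi psi : A -> A) : q != 1 ->
  algebra_morphism phi -> algebra_morphism psi -> cancel psi phi ->
  forall i j, qcoef (phi (x1 * x2)) i j != 0 -> (i = 1 /\ j = 1)%N.
Proof.
move=> q1 hphi hpsi psiK.
have [z ez] := algmor_x1x2 q1 hphi; have [y ey] := algmor_x1x2 q1 hpsi.
have x12E : x1 * x2 = x1 * x2 * (z * phi y).
  by rewrite -{1}(psiK (x1 * x2)) ey (algmor_mul hphi) ez mulrA.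
have nz : z != 0.
  by have := x1x2_neq0 q; apply: contra => /eqP z0; rewrite x12E z0 mul0r mulr0.
have ny : phi y != 0.
  by have := x1x2_neq0 q; apply: contra => /eqP z0; rewrite x12E z0 !mulr0.
have [a ea] := extremal_lex nz; have [b eb] := extremal_lex ny.
have a0 : a = (0, 0)%N.
  have := extremalM separating_lex ea eb.
  move=> /(congr1 (fun x => q ^+ (a.1 + b.1) * x)).
  rewrite -qcoef_x1x2M -x12E qcoef_x1x2.
  case: a b ea eb => [[|a1] [|a2]] [b1 b2] [ua _] [ub _] //=;
    rewrite ?addSn ?eqSS ?andbF //= => /esym/eqP;
    rewrite !mulf_eq0 !expf_eq0 (negbTE q_neq0);
    by rewrite ?(negbTE ua) ?(negbTE ub) !andbF.
move=> i j; rewrite ez; case: i j => [|i] [|j];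
  try by rewrite (qcoefM_monomial 1 1) eqxx.
rewrite qcoef_x1x2M mulf_eq0 negb_or => /andP[_].
case: ea => _; rewrite a0 => zE.
by case: i j => [|i] [|j] //; rewrite (zE (_, _)) ?eqxx // /lex /=.
Qed.

Lemma extremal_monomial u a : extremal lex u a -> extremal lex_gt u a ->
  u = qcoef u a.1 a.2 *: (x1 ^+ a.1 * x2 ^+ a.2).
Proof.
case: a => [a1 a2] /= [_ up] [_ dn]; apply: qcoefP => i j.
rewrite qcoefZ qcoef_monomial; have := up (i, j); have := dn (i, j).
rewrite /lex /=; case: ltngtP => [_ ->|_ _ ->|->] //=; rewrite ?andbF ?mulr0 //.
by case: ltngtP => [_ ->|_ _ ->|->] //=; rewrite ?mulr0 ?mulr1.
Qed.

(** Leading exponents add up to [(1, 1)], and so do trailing exponents; as a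
    leading exponent is never below the trailing one, the two coincide in each
    factor. *)
Lemma factor_x1x2 u w : u != 0 -> w != 0 ->
  (forall i j, qcoef (u * w) i j != 0 -> (i = 1 /\ j = 1)%N) ->
  exists a b c d, [/\ c != 0 /\ d != 0, (a.1 + b.1 = 1 /\ a.2 + b.2 = 1)%N,
    u = c *: (x1 ^+ a.1 * x2 ^+ a.2) & w = d *: (x1 ^+ b.1 * x2 ^+ b.2)].
Proof.
move=> u0 w0 uw.
have [a ea] := extremal_lex u0; have [b eb] := extremal_lex w0.
have [a' ea'] := extremal_lex_gt u0; have [b' eb'] := extremal_lex_gt w0.
have sum11 r (s t : nat * nat) : separating r -> extremal r u s -> extremal r w t ->
    (s.1 + t.1 = 1 /\ s.2 + t.2 = 1)%N.
  move=> hr es et; apply: uw; rewrite (extremalM hr es et).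
  by case: es et => us _ [wt _]; rewrite !mulf_neq0 ?expf_neq0.
have [ab1 ab2] := sum11 _ _ _ separating_lex ea eb.
have [ab1' ab2'] := sum11 _ _ _ separating_lex_gt ea' eb'.
have la : ~~ lex a a'.
  by apply/negP => l; case: ea' => + _; case: ea => _ /(_ _ l) ->; rewrite eqxx.
have lb : ~~ lex b b'.
  by apply/negP => l; case: eb' => + _; case: eb => _ /(_ _ l) ->; rewrite eqxx.
have [aa' bb'] : a' = a /\ b' = b.
  move: ab1 ab2 ab1' ab2' la lb; rewrite /lex.
  case: (a) (b) (a') (b') => [? ?] [? ?] [? ?] [? ?] /= *.
  by split; congr pair; lia.
rewrite {}aa' in ea'; rewrite {}bb' in eb'.
exists a, b, (qcoef u a.1 a.2), (qcoef w b.1 b.2); split=> //.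
- by case: ea eb => ua _ [wb _].
- exact: extremal_monomial.
- exact: extremal_monomial.
Qed.

(** The images of [x1] and [x2] are monomials with product [x1 * x2] up to a
    scalar.  If one of them is a scalar the relation forces [q = 1]; if they are
    exchanged it forces [q ^+ 2 = 1]. *)
Lemma automorphism_diagonal (phi psi : A -> A) : q ^+ 2 != 1 ->
  algebra_morphism phi -> algebra_morphism psi -> cancel psi phi -> cancel phi psi ->
  exists c : F * F, [/\ c.1 != 0, c.2 != 0, phi x1 = c.1 *: x1 & phi x2 = c.2 *: x2].
Proof.
move=> q2 hphi hpsi psiK phiK.
have q1 : q != 1 by apply: contra q2 => /eqP ->; rewrite expr1n.
have phiM := algmor_mul hphi.
have phi_neq0 u : u != 0 -> phi u != 0.
  apply: contra => /eqP pu.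
  by rewrite -(phiK u) pu (linear_fun0 (algmor_linear hpsi)).
have n1 : phi x1 != 0.
  by apply: phi_neq0; have := x1x2_neq0 q; apply: contra => /eqP ->; rewrite mul0r.
have n2 : phi x2 != 0.
  by apply: phi_neq0; have := x1x2_neq0 q; apply: contra => /eqP ->; rewrite mulr0.
have [|a [b [c [d [[c0 d0] [ab1 ab2] e1 e2]]]]] := factor_x1x2 n1 n2.
  by rewrite -phiM; apply: (qcoef_automorphism_x1x2 q1 hphi hpsi psiK).
have coef11 k l (s t : nat * nat) : (s.1 + t.1 = 1)%N -> (s.2 + t.2 = 1)%N ->
    qcoef ((k *: (x1 ^+ s.1 * x2 ^+ s.2) : A) * (l *: (x1 ^+ t.1 * x2 ^+ t.2))) 1 1 =
    q ^+ (s.2 * t.1) * (k * l).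
  move=> st1 st2; rewrite -scalerAl -scalerAr !qcoefZ.
  rewrite -[X in qcoef _ X _]st1 -[X in qcoef _ _ X]st2 qcoefM_monomial qcoef_monomial.
  by rewrite !leq_addr !addKn !eqxx /= mulr1 mulrA mulrC.
have := congr1 phi (x2x1 q); rewrite (linear_funZ (algmor_linear hphi)) !phiM e1 e2.
move=> /(congr1 (fun u => qcoef u 1 1)); rewrite qcoefZ !coef11 //; try lia.
rewrite [d * c]mulrC [X in _ = X -> _]mulrA => /(mulIf (mulf_neq0 c0 d0)).
case: a b ab1 ab2 e1 e2 => [a1 a2] [b1 b2] /= ab1 ab2 e1 e2.
have : [\/ [/\ a1 = 1, a2 = 0, b1 = 0 & b2 = 1]%N, [/\ a1 = 0, a2 = 1, b1 = 1 & b2 = 0]%N,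
    [/\ a1 = 1, a2 = 1, b1 = 0 & b2 = 0]%N | [/\ a1 = 0, a2 = 0, b1 = 1 & b2 = 1]%N].
  case: a1 a2 ab1 ab2 {e1} => [|[|a1]] [|[|a2]] ab1 ab2;
    try (by exfalso; lia); [apply: Or44|apply: Or42|apply: Or41|apply: Or43]; split; lia.
case=> -[? ? ? ?]; subst; rewrite ?(expr0, expr1, mulr1, mul1r).
- by move=> _; exists (c, d).
- by move=> qq; case/eqP: q2; rewrite expr2.
- by move=> qq; case/eqP: q1.
- by move=> qq; case/eqP: q1.
Qed.

Lemma qcoef_diagonal (phi : A -> A) (c1 c2 : F) : algebra_morphism phi ->
  phi x1 = c1 *: x1 -> phi x2 = c2 *: x2 ->
  forall u i j, qcoef (phi u) i j = c1 ^+ i * c2 ^+ j * qcoef u i j.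
Proof.
move=> [lphi phi1 phiM] e1 e2 u n m.
have phiX v k : phi (v ^+ k) = phi v ^+ k.
  by elim: k => [|k IHk]; rewrite ?expr0 // !exprS phiM IHk.
rewrite (linear_qplane_expand (f := fun u => qcoef (phi u) n m : F^o)); last first.
  by move=> c u' w'; rewrite lphi qcoef_linear.
rewrite [qcoef u _ _](linear_qplane_expand (f := fun u => qcoef u n m : F^o)); last first.
  exact: qcoef_linear.
rewrite mulr_sumr; apply: eq_bigr => j _; rewrite mulr_sumr; apply: eq_bigr => i _.
rewrite phiM !phiX e1 e2 !exprZn -scalerAl -scalerAr !qcoefZ qcoef_monomial.
rewrite /GRing.scale /=; case: eqP => [->|_]; last by rewrite !mulr0.
by case: eqP => [->|_]; rewrite /= ?mulr0 // !mulr1 mulrC.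
Qed.

End Automorphisms.

(** * Module algebras over a presented bialgebra *)

Section ModuleAlgebraFromGenerators.
Variables (K : fieldType) (X : Type) (rel : presentation K X) (A : algType K).
Local Notation H := (presented_algebra rel).
Variables (Delta : H -> tensor H H) (eps : H -> K^o).
Hypotheses (DeltaP : algebra_morphism Delta) (epsP : algebra_morphism eps).
Variable act : H -> lend (oner_neq0 A).
Hypothesis actP : algebra_morphism act.

(** One decomposition of [Delta h] is enough, see [leibnizP]; this is what makes
    the rule inductive in [h]. *)
Definition leibniz (h : H) : Prop := exists s : seq (H * H),
  Delta h = \sum_(p <- s) pure p.1 p.2 /\ forall a b,
    lend_fun (act h) (a * b) =
    \sum_(p <- s) lend_fun (act p.1) a * lend_fun (act p.2) b.

Let lact := algmor_linear actP.

Lemma act_bilinear a b :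
  bilinear_map (fun g h : H => lend_fun (act g) a * lend_fun (act h) b).
Proof.
split=> [h|g] c x y; rewrite lact lend_funD lend_funZ.
- by rewrite mulrDl scalerAl.
- by rewrite mulrDr scalerAr.
Qed.

(** Both sides are values of the linear map on the tensor square induced by
    [act_bilinear], and two decompositions of [Delta h] are the same tensor. *)
Lemma leibnizP h s : leibniz h -> Delta h = \sum_(p <- s) pure p.1 p.2 ->
  forall a b, lend_fun (act h) (a * b) =
    \sum_(p <- s) lend_fun (act p.1) a * lend_fun (act p.2) b.
Proof.
case=> t [ht act_t] hs a b; rewrite act_t.
by move: ht; rewrite hs => /sum_pure_eq/(_ _ _ (act_bilinear a b)) ->.
Qed.

(** For a product, decompositions of [Delta g] and [Delta h] multiply to one of
    [Delta (g * h)], because [Delta] is an algebra morphism. *)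
Lemma leibniz_gen : (forall x, leibniz (pgen rel x)) -> forall h, leibniz h.
Proof.
move=> gen; elim/presented_ind => [//|c|g h [s [hs act_s]] [t [ht act_t]]|
    g h [s [hs act_s]] [t [ht act_t]]].
- exists [:: (c *: 1, 1)]; split=> [|a b].
    by rewrite (linear_funZ (algmor_linear DeltaP)) (algmor_one DeltaP) big_seq1 pureZl.
  rewrite big_seq1 /= (linear_funZ lact) (algmor_one actP) !lend_funZ !lend_fun1.
  by rewrite scalerAl.
- exists (s ++ t); split=> [|a b].
    by rewrite (linear_funD (algmor_linear DeltaP)) hs ht big_cat.
  by rewrite (linear_funD lact) lend_funD act_s act_t big_cat.
- exists [seq (p.1 * r.1, p.2 * r.2) | p <- s, r <- t]; split=> [|a b].
    rewrite (algmor_mul DeltaP) hs ht big_allpairs_dep mulr_suml /=.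
    apply: eq_bigr => p _; rewrite mulr_sumr; apply: eq_bigr => r _; exact: pureM.
  rewrite (algmor_mul actP) lend_funM act_t (linear_fun_sum (lend_linear _)).
  rewrite big_allpairs_dep exchange_big /=; apply: eq_bigr => r _.
  rewrite act_s; apply: eq_bigr => p _.
  by rewrite !(algmor_mul actP) !lend_funM.
Qed.

Lemma counit_gen :
  (forall x, lend_fun (act (pgen rel x)) 1 = eps (pgen rel x) *: 1) ->
  forall h, lend_fun (act h) 1 = eps h *: 1.
Proof.
move=> gen; elim/presented_ind => [//|c|g h eg eh|g h eg eh].
- rewrite (linear_funZ lact) (linear_funZ (algmor_linear epsP)).
  rewrite (algmor_one actP) (algmor_one epsP) lend_funZ lend_fun1.
  by rewrite /(_ *: (1 : K^o)) /= mulr1.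
- rewrite (linear_funD lact) (linear_funD (algmor_linear epsP)) lend_funD eg eh.
  by rewrite scalerDl.
- rewrite (algmor_mul actP) (algmor_mul epsP) lend_funM eh.
  by rewrite (linear_funZ (lend_linear _)) eg scalerA mulrC.
Qed.

Lemma module_algebra_gen :
  (forall x, leibniz (pgen rel x)) ->
  (forall x, lend_fun (act (pgen rel x)) 1 = eps (pgen rel x) *: 1) ->
  module_algebra Delta eps (fun h => lend_fun (act h)).
Proof.
move=> gen gen1; split.
- by move=> h; apply: lend_linear.
- by move=> a c g h; rewrite lact.
- by move=> a; rewrite (algmor_one actP).
- by move=> g h a; rewrite (algmor_mul actP).
- by move=> h s hs a b; apply: leibnizP => //; apply: leibniz_gen.
- exact: counit_gen.
Qed.

End ModuleAlgebraFromGenerators.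

Lemma module_algebra_ext (K : fieldType) (X : Type) (rel : presentation K X)
    (A : algType K) Delta eps (act act' : presented_algebra rel -> A -> A) :
  module_algebra Delta eps act -> module_algebra Delta eps act' ->
  (forall x, act (pgen rel x) =1 act' (pgen rel x)) -> act = act'.
Proof.
move=> ha ha' gen; apply: funext; elim/presented_ind => [x|c|g h eg eh|g h eg eh].
- exact/funext/gen.
- apply: funext => a; rewrite (linear_funZ (act_linearl ha a)).
  by rewrite (linear_funZ (act_linearl ha' a)) (act_one ha) (act_one ha').
- apply: funext => a; rewrite (linear_funD (act_linearl ha a)).
  by rewrite (linear_funD (act_linearl ha' a)) eg eh.
- by apply: funext => a; rewrite (act_mul ha) (act_mul ha') eg eh.
Qed.

(** Covers [e_i], with [g] the identity, and [f_i], with [h] the identity. *)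
Lemma skew_derivation_eq0 (K : fieldType) (X : Type) (rel : presentation K X)
    (D g h : presented_algebra rel -> presented_algebra rel) :
  linear D -> D 1 = 0 -> (forall a b, D (a * b) = g a * D b + D a * h b) ->
  (forall x, D (pgen rel x) = 0) -> forall a, D a = 0.
Proof.
move=> lD D1 DM gen; elim/presented_ind => [//|c|a b Da Db|a b Da Db].
- by rewrite (linear_funZ lD) D1 scaler0.
- by rewrite (linear_funD lD) Da Db addr0.
- by rewrite DM Da Db mulr0 mul0r addr0.
Qed.

(** * Actions of the quantum group on the quantum plane *)

Section Actions.
Variables (F : fieldType) (q : F) (m : nat).
Hypothesis q_neq0 : q != 0.
Hypothesis q_not_root1 : forall n : nat, (0 < n)%N -> q ^+ n != 1.
Local Notation A := (qplane q).
Local Notation U := (Uq m q).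

Lemma qexpz_eq1 (z : int) : q ^ z = 1 -> z = 0.
Proof.
case: z => [[//|n]|n] /eqP; first by rewrite -exprnP (negbTE (q_not_root1 _)).
by rewrite NegzE -exprnN invr_eq1 (negbTE (q_not_root1 _)).
Qed.

Section Action.
Variable act : U -> A -> A.
Hypothesis actP : module_algebra Uq_comul Uq_counit act.

Lemma actZ c h a : act (c *: h) a = c *: act h a.
Proof. exact: (linear_funZ (act_linearl actP a)). Qed.
Lemma actB h g a : act (h - g) a = act h a - act g a.
Proof. exact: (linear_funB (act_linearl actP a)). Qed.
Lemma act0r h : act h 0 = 0.
Proof. exact: linear_fun0 (act_linear actP h). Qed.
Lemma actZr h c a : act h (c *: a) = c *: act h a.
Proof. exact: (linear_funZ (act_linear actP h)). Qed.

Lemma act_prod_gen (x : Uq_gen m) (s : seq (U * U)) :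
  Uq_comul_gen q x = \sum_(p <- s) pure p.1 p.2 -> forall a b,
  act (pgen (Uq_presentation m q) x) (a * b) = \sum_(p <- s) act p.1 a * act p.2 b.
Proof. by move=> xs; apply: (act_prod actP); rewrite (Uq_comul_pgen q_neq0). Qed.

Lemma act_unit_gen (x : Uq_gen m) :
  act (pgen (Uq_presentation m q) x) 1 = (Uq_counit_gen F x : F) *: 1.
Proof. by rewrite (act_unit actP) Uq_counit_pgen. Qed.

Lemma act_k_morph i : algebra_morphism (act (Uk i)).
Proof.
split=> [||a b]; first exact: act_linear actP _.
- by rewrite (act_unit_gen (Uq_K i)) scale1r.
- by rewrite (@act_prod_gen (Uq_K i) [:: (Uk i, Uk i)]) big_seq1.
Qed.

Lemma act_kinv_morph i : algebra_morphism (act (Ukinv i)).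
Proof.
split=> [||a b]; first exact: act_linear actP _.
- by rewrite (act_unit_gen (Uq_Kinv i)) scale1r.
- by rewrite (@act_prod_gen (Uq_Kinv i) [:: (Ukinv i, Ukinv i)]) big_seq1.
Qed.

Lemma act_kK i : cancel (act (Uk i)) (act (Ukinv i)).
Proof. by move=> a; rewrite -(act_mul actP) UkVk (act_one actP). Qed.

Lemma act_kVK i : cancel (act (Ukinv i)) (act (Uk i)).
Proof. by move=> a; rewrite -(act_mul actP) UkkV (act_one actP). Qed.

Lemma act_eM i a b :
  act (Ue i) (a * b) = a * act (Ue i) b + act (Ue i) a * act (Uk i) b.
Proof.
rewrite (@act_prod_gen (Uq_E i) [:: (1, Ue i); (Ue i, Uk i)]) big_cons big_seq1 //=.
by rewrite (act_one actP).
Qed.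

Lemma act_fM i a b :
  act (Uf i) (a * b) = act (Ukinv i) a * act (Uf i) b + act (Uf i) a * b.
Proof.
rewrite (@act_prod_gen (Uq_F i) [:: (Ukinv i, Uf i); (Uf i, 1)]) big_cons big_seq1 //=.
by rewrite (act_one actP).
Qed.

Definition kills (h : U) : Prop := act h x1 = 0 /\ act h x2 = 0.

Lemma act_e_eq0 i : kills (Ue i) -> forall a, act (Ue i) a = 0.
Proof.
case=> e1 e2; apply: (skew_derivation_eq0 (act_linear actP _) _ (act_eM i)); last by case.
by rewrite (act_unit_gen (Uq_E i)) scale0r.
Qed.

Lemma act_f_eq0 i : kills (Uf i) -> forall a, act (Uf i) a = 0.
Proof.
case=> e1 e2; apply: (skew_derivation_eq0 (act_linear actP _) _ (act_fM i)); last by case.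
by rewrite (act_unit_gen (Uq_F i)) scale0r.
Qed.

Lemma act_k_diagonal : exists c : 'I_m -> F * F, forall i,
  [/\ (c i).1 != 0, (c i).2 != 0, act (Uk i) x1 = (c i).1 *: x1
    & act (Uk i) x2 = (c i).2 *: x2].
Proof.
have diag i : exists d : F * F, [/\ d.1 != 0, d.2 != 0,
    act (Uk i) x1 = d.1 *: x1 & act (Uk i) x2 = d.2 *: x2].
  apply: (automorphism_diagonal q_neq0 (q_not_root1 _)) => //.
  - exact: act_k_morph.
  - exact: act_kinv_morph.
  - exact: act_kVK.
  - exact: act_kK.
by have [c cP] := choice diag; exists c.
Qed.

Section Weights.
Variable c : 'I_m -> F * F.
Hypothesis cP : forall i, [/\ (c i).1 != 0, (c i).2 != 0, act (Uk i) x1 = (c i).1 *: x1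
    & act (Uk i) x2 = (c i).2 *: x2].

Definition degree_weight (r s : int) (i : 'I_m) : F := (c i).1 ^ r * (c i).2 ^ s.

(** [k_j] multiplies [h(x1)] by [q ^ b j * (c j).1], and the coefficient of
    [x1 ^+ n * x2 ^+ k] by [(c j).1 ^+ n * (c j).2 ^+ k].  A nonzero coefficient
    of [h(x1)] thus has the degree shift [(n - 1, k)]; one of [h(x2)] has
    [(n, k - 1)]. *)
Lemma weight_degree (h : U) (b : 'I_m -> int) :
  (forall j, Uk j * h = q ^ b j *: (h * Uk j)) -> ~ kills h ->
  exists r s : int, forall j, degree_weight r s j = q ^ b j.
Proof.
move=> kh; have kact j x (d : F) : act (Uk j) x = d *: x ->
    act (Uk j) (act h x) = (q ^ b j * d) *: act h x.
  by move=> kx; rewrite -(act_mul actP) kh actZ (act_mul actP) kx actZr scalerA.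
have wt j x d n k : act (Uk j) x = d *: x -> qcoef (act h x) n k != 0 ->
    (c j).1 ^+ n * (c j).2 ^+ k = q ^ b j * d.
  move=> /kact kx nz; have [_ _ k1 k2] := cP j.
  have := qcoef_diagonal (act_k_morph j) k1 k2 (act h x) n k.
  by rewrite kx qcoefZ => /(mulIf nz).
have nz x : act h x <> 0 -> exists n k, qcoef (act h x) n k != 0.
  move=> hx; apply: contrapT => nex; apply: hx; apply: qcoefP => n k.
  rewrite qcoef0; apply: contrapT => nk; apply: nex; exists n, k; exact/eqP.
move=> /not_andP[/nz|/nz] [n [k nk]].
- exists (n%:Z - 1), k%:Z => j; have [c1 c2 k1 _] := cP j.
  rewrite /degree_weight expfzDr // -exprnP -exprnP exprN1 mulrAC.
  by rewrite (wt j _ _ _ _ k1 nk) mulfK.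
- exists n%:Z, (k%:Z - 1) => j; have [c1 c2 _ k2] := cP j.
  rewrite /degree_weight expfzDr // -exprnP -exprnP exprN1 mulrA.
  by rewrite (wt j _ _ _ _ k2 nk) mulfK.
Qed.

(** If [e_i] acts by zero, so does [[e_i, f_i]], which is [k_i - k_i^-1] up to a
    nonzero scalar. *)
Lemma kills_e_signs i : kills (Ue i) -> (c i).1 ^+ 2 = 1 /\ (c i).2 ^+ 2 = 1.
Proof.
move=> /act_e_eq0 ei; have [c1 c2 k1 k2] := cP i.
have qq : q - q^-1 != 0.
  rewrite subr_eq0; apply: contra (q_not_root1 (isT : (0 < 2)%N)) => /eqP qV.
  by rewrite expr2 {2}qV mulfV.
have kkV a : act (Uk i) a = act (Ukinv i) a.
  have := congr1 (act^~ a) (Uef (m := m) q i i); rewrite eqxx /= actB actZ actB.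
  rewrite !(act_mul actP) !ei act0r subrr => /esym/eqP.
  by rewrite scaler_eq0 invr_eq0 (negbTE qq) subr_eq0 => /eqP.
have sq (x : A) d : x != 0 -> act (Uk i) x = d *: x -> d ^+ 2 = 1.
  move=> x0 kx; have := act_kVK i x; rewrite -kkV kx actZr kx scalerA -{2}[x]scale1r.
  move=> /eqP; rewrite -subr_eq0 -scalerBl scaler_eq0 (negbTE x0) orbF subr_eq0.
  by rewrite expr2 => /eqP.
have := x1x2_neq0 q; rewrite -[_ == 0]/(_ == 0) => n12.
split; [apply: (sq x1) => //|apply: (sq x2) => //]; apply: contra n12 => /eqP ->.
- by rewrite mul0r.
- by rewrite mulr0.
Qed.

(** Squaring [degree_weight r s i = q ^ b i] would give [q ^ (b i * 2) = 1]. *)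
Lemma kills_weight i (h : U) (b : 'I_m -> int) :
  (c i).1 ^+ 2 = 1 -> (c i).2 ^+ 2 = 1 ->
  (forall j, Uk j * h = q ^ b j *: (h * Uk j)) -> b i <> 0 -> kills h.
Proof.
move=> s1 s2 kh bi; apply: contrapT => /(weight_degree kh) [r [s /(_ i) rs]].
have : q ^ (b i * 2) = 1.
  rewrite -exprz_exp -rs /degree_weight expfzMl !exprz_exp ![_ * 2]mulrC -!exprz_exp.
  by rewrite -!exprnP s1 s2 !exp1rz mulr1.
by move/qexpz_eq1; lia.
Qed.

Lemma kills_f_of_e i : kills (Ue i) -> kills (Uf i).
Proof.
move=> /kills_e_signs[s1 s2]; apply: (kills_weight s1 s2 (fun j => Ukf q j i)).
by rewrite cartan_ii.
Qed.

Lemma kills_e_neighbour i j : kills (Ue i) -> cartan i j <> 0 -> kills (Ue j).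
Proof.
move=> /kills_e_signs[s1 s2] ij; exact: (kills_weight s1 s2 (fun l => Uke q l j)).
Qed.

Lemma cartan_succ (i j : 'I_m) : (i.+1 = j :> nat) -> cartan i j = -1.
Proof.
by move=> ij; rewrite /cartan -val_eqE /= -ij eqxx; case: eqP => //; lia.
Qed.

(** The Dynkin diagram is a path: go down to its first vertex, then up. *)
Lemma kills_e_all i : kills (Ue i) -> forall j, kills (Ue j).
Proof.
move=> ki; pose P n := forall h : (n < m)%N, kills (Ue (Ordinal h)).
have down n : (n.+1 < m)%N -> P n.+1 -> P n.
  move=> h Pn h'; apply: kills_e_neighbour (Pn h) _.
  by rewrite cartanC (cartan_succ (i := Ordinal h')).
have up n : P n -> P n.+1.
  move=> Pn h; apply: kills_e_neighbour (Pn (ltnW h)) _.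
  by rewrite (cartan_succ (i := Ordinal (ltnW h))).
have P0 : P 0%N.
  have [n le] := ubnPgeq (i : nat).
  have : P i by move=> h; rewrite (_ : Ordinal h = i) //; apply: val_inj.
  have := ltn_ord i; elim: (i : nat) => [//|k IHk] h Pk.
  by apply: IHk (ltnW h) (down _ h Pk).
move=> j; have Pj : P j by elim: (j : nat) => [//|k IHk]; apply: up.
by have := Pj (ltn_ord j); rewrite (_ : Ordinal _ = j) //; apply: val_inj.
Qed.

(** The weight is multiplicative in the degree shift, so a relation between the
    shifts makes the corresponding power of [q] equal to 1. *)
Lemma weight_relation (i0 i1 i2 : 'I_m) (r s : 'I_m -> int) (n0 n1 n2 : int) :
  (forall i j, degree_weight (r i) (s i) j = q ^ cartan j i) ->
  n0 * r i0 + n1 * r i1 + n2 * r i2 = 0 -> n0 * s i0 + n1 * s i1 + n2 * s i2 = 0 ->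
  forall j, n0 * cartan j i0 + n1 * cartan j i1 + n2 * cartan j i2 = 0.
Proof.
move=> rs rel_r rel_s j; apply: qexpz_eq1; have [c1 c2 _ _] := cP j.
have wz n i : q ^ (n * cartan j i) = (c j).1 ^ (n * r i) * (c j).2 ^ (n * s i).
  by rewrite ![n * _]mulrC -!exprz_exp -rs /degree_weight expfzMl.
rewrite !expfzDr // !wz.
transitivity ((c j).1 ^ (n0 * r i0 + n1 * r i1 + n2 * r i2) *
              (c j).2 ^ (n0 * s i0 + n1 * s i1 + n2 * s i2)).
  by rewrite !expfzDr //; ring.
by rewrite rel_r rel_s !expr0z mulr1.
Qed.

(** Otherwise the three columns of the Cartan matrix at consecutive vertices, which
    are independent, would come from three vectors of [Z^2]. *)
Lemma exists_kills_e : (3 <= m)%N -> exists i, kills (Ue i).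
Proof.
move=> m3; apply: contrapT => nk.
have deg i : exists p : int * int, forall j, degree_weight p.1 p.2 j = q ^ cartan j i.
  have [|r [s rs]] := @weight_degree (Ue i) (fun j => cartan j i) (fun j => Uke q j i).
    by move=> ki; apply: nk; exists i.
  by exists (r, s).
have [d dP] := choice deg.
have h0 : (0 < m)%N by lia. have h1 : (1 < m)%N by lia.
pose i0 := Ordinal h0; pose i1 := Ordinal h1; pose i2 := Ordinal m3.
have indep n0 n1 n2 : n0 * (d i0).1 + n1 * (d i1).1 + n2 * (d i2).1 = 0 ->
    n0 * (d i0).2 + n1 * (d i1).2 + n2 * (d i2).2 = 0 -> n0 = 0 /\ n1 = 0 /\ n2 = 0.
  move=> e1 e2; have W := weight_relation dP e1 e2.
  have := W i0; have := W i1; have := W i2; rewrite /cartan /=.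
  lia.
(* The 2 x 2 minors are the coefficients of a relation between three plane
   vectors, so they vanish; then each coordinate of the first two vectors gives
   a relation between these, and the first vector is zero. *)
have [|| z0 [z1 z2]] := indep ((d i1).1 * (d i2).2 - (d i2).1 * (d i1).2)
  ((d i2).1 * (d i0).2 - (d i0).1 * (d i2).2) ((d i0).1 * (d i1).2 - (d i1).1 * (d i0).2).
- by ring.
- by ring.
have [|| r1 [r0 _]] := indep (- (d i1).1) (d i0).1 0; [by ring|by lia|].
have [|| s1 [s0 _]] := indep (- (d i1).2) (d i0).2 0; [by lia|by ring|].
by have [||] := indep 1 0 0; [lia|lia|case].
Qed.

End Weights.

Lemma action_signs : (3 <= m)%N -> exists s1 s2 : 'I_m -> bool, sign_action act s1 s2.
Proof.
move=> m3; have [c cP] := act_k_diagonal.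
have [i /(kills_e_all cP) ke] := exists_kills_e cP m3.
have sgn (d : F) : d ^+ 2 = 1 -> d = (-1) ^+ (d != 1).
  by move/eqP; rewrite sqrf_eq1; case: eqVneq => [-> _|_ /eqP].
exists (fun i => (c i).1 != 1), (fun i => (c i).2 != 1) => j.
have [s1 s2] := kills_e_signs cP (ke j); have [_ _ k1 k2] := cP j.
by split; rewrite -?sgn //; [apply: ke|apply: (kills_f_of_e cP)].
Qed.

End Action.

(** The [k_i] act by algebra morphisms, which two values determine, and the [k_i^-1]
    by their inverses; the [e_i] and [f_i] act by skew derivations. *)
Lemma sign_action_unique (act act' : U -> A -> A) s1 s2 :
  module_algebra Uq_comul Uq_counit act -> module_algebra Uq_comul Uq_counit act' ->
  sign_action act s1 s2 -> sign_action act' s1 s2 -> act = act'.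
Proof.
move=> aP aP' sa sa'; apply: (module_algebra_ext aP aP').
have kE i : act (Uk i) =1 act' (Uk i).
  apply: (presented_morph_ext (act_k_morph aP i) (act_k_morph aP' i)).
  by have [k1 k2 _ _] := sa i; have [k1' k2' _ _] := sa' i; case; rewrite /= ?k1 ?k1' ?k2 ?k2'.
case=> i a.
- have [_ _ ke _] := sa i; have [_ _ ke' _] := sa' i.
  by rewrite (act_e_eq0 aP ke) (act_e_eq0 aP' ke').
- have [_ _ _ ke] := sa i; have [_ _ _ ke'] := sa' i.
  by rewrite (act_f_eq0 aP ke) (act_f_eq0 aP' ke').
- exact: kE.
- rewrite -[pgen _ _]/(Ukinv i) -{1}(act_kVK aP' i a) -kE.
  exact: (act_kK aP i).
Qed.

(** * The sign actions exist *)

Definition sign_gen (b1 b2 : bool) (x : qplane_gen) : A :=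
  match x with
  | qplane_X1 => (-1) ^+ b1 *: x1
  | qplane_X2 => (-1) ^+ b2 *: x2
  end.

Lemma sign_gen_rel b1 b2 t u : qplane_presentation q t u ->
  aeval (sign_gen b1 b2) t = aeval (sign_gen b1 b2) u.
Proof.
case=> /=; rewrite -!scalerAl mul1r -!scalerAr [_ * x1]x2x1 !scalerA.
by congr (_ *: _); ring.
Qed.

Definition sign_aut b1 b2 : A -> A := plift (sign_gen b1 b2).

Lemma sign_autP b1 b2 : algebra_morphism (sign_aut b1 b2).
Proof. exact/pliftP/sign_gen_rel. Qed.

Lemma sign_aut1 b1 b2 : sign_aut b1 b2 x1 = (-1) ^+ b1 *: x1.
Proof. exact/plift_gen/sign_gen_rel. Qed.
Lemma sign_aut2 b1 b2 : sign_aut b1 b2 x2 = (-1) ^+ b2 *: x2.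
Proof. exact/plift_gen/sign_gen_rel. Qed.

Definition sign_lend b1 b2 : lend (oner_neq0 A) :=
  mk_lend _ (algmor_linear (sign_autP b1 b2)).

Lemma sign_lendC b1 b2 d1 d2 :
  sign_lend b1 b2 * sign_lend d1 d2 = sign_lend d1 d2 * sign_lend b1 b2.
Proof.
apply: lendP => a; rewrite !lend_funM /=.
apply: (presented_morph_ext (algmor_comp (sign_autP _ _) (sign_autP _ _))
         (algmor_comp (sign_autP _ _) (sign_autP _ _))) a => -[] /=.
- by rewrite !(sign_aut1, linear_funZ (algmor_linear (sign_autP _ _)), scalerA) mulrC.
- by rewrite !(sign_aut2, linear_funZ (algmor_linear (sign_autP _ _)), scalerA) mulrC.
Qed.

Lemma sign_lendK b1 b2 : sign_lend b1 b2 * sign_lend b1 b2 = 1.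
Proof.
have idP : algebra_morphism (@id A) by [].
apply: lendP => a; rewrite lend_funM /=.
apply: (presented_morph_ext (algmor_comp (sign_autP _ _) (sign_autP _ _)) idP) a => -[] /=.
- rewrite !(sign_aut1, linear_funZ (algmor_linear (sign_autP _ _)), scalerA).
  by rewrite -signr_addb addbb scale1r.
- rewrite !(sign_aut2, linear_funZ (algmor_linear (sign_autP _ _)), scalerA).
  by rewrite -signr_addb addbb scale1r.
Qed.

Section SignAction.
Variables s1 s2 : 'I_m -> bool.

Definition sign_action_gen (x : Uq_gen m) : lend (oner_neq0 A) :=
  match x with
  | Uq_E _ | Uq_F _ => 0
  | Uq_K i | Uq_Kinv i => sign_lend (s1 i) (s2 i)
  end.

Lemma sign_action_rel t u : Uq_relation q t u ->
  aeval sign_action_gen t = aeval sign_action_gen u.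
Proof.
case=> [i|i|i j|i j|i j|i j|i j _|i j _|i j _|i j _] /=;
  rewrite ?(mulr0, mul0r, addr0, scale0r) ?scale1r ?sign_lendK //.
- exact: sign_lendC.
- case: (i == j) => /=; rewrite ?scale0r //.
  by rewrite -!scalerAl !mul1r scaleN1r subrr scaler0.
Qed.

Definition sign_rep : U -> lend (oner_neq0 A) := plift sign_action_gen.

Lemma sign_repP : algebra_morphism sign_rep.
Proof. exact/pliftP/sign_action_rel. Qed.

Lemma sign_rep_gen x : sign_rep (pgen _ x) = sign_action_gen x.
Proof. exact/plift_gen/sign_action_rel. Qed.

Lemma sign_rep_module_algebra :
  module_algebra Uq_comul Uq_counit (fun h : U => lend_fun (sign_rep h)).
Proof.
refine (@module_algebra_gen F _ (Uq_presentation m q) A (@Uq_comul F m q)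
  (@Uq_counit F m q) (Uq_comulP m q_neq0) (Uq_counitP m q) sign_rep sign_repP _ _) => x.
  rewrite /leibniz Uq_comul_pgen //.
  exists (match x with
    | Uq_E i => [:: (1, Ue i); (Ue i, Uk i)]
    | Uq_F i => [:: (Ukinv i, Uf i); (Uf i, 1)]
    | Uq_K i => [:: (Uk i, Uk i)]
    | Uq_Kinv i => [:: (Ukinv i, Ukinv i)]
    end).
  split=> [|a b]; first by case: x => i; rewrite ?big_cons ?big_nil ?addr0.
  rewrite sign_rep_gen; case: x => i; rewrite ?big_cons ?big_nil ?addr0 /=.
  - by rewrite [sign_rep (Ue i)]sign_rep_gen /= mulr0 mul0r addr0.
  - by rewrite [sign_rep (Uf i)]sign_rep_gen /= mulr0 mul0r addr0.
  - by rewrite [sign_rep (Uk i)]sign_rep_gen /= (algmor_mul (sign_autP _ _)).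
  - by rewrite [sign_rep (Ukinv i)]sign_rep_gen /= (algmor_mul (sign_autP _ _)).
rewrite sign_rep_gen Uq_counit_pgen; case: x => i /=;
  by rewrite ?scale0r ?scale1r // (algmor_one (sign_autP _ _)).
Qed.

Lemma sign_rep_signs : sign_action (fun h : U => lend_fun (sign_rep h)) s1 s2.
Proof.
move=> i; split.
- by rewrite [sign_rep (Uk i)]sign_rep_gen /= sign_aut1.
- by rewrite [sign_rep (Uk i)]sign_rep_gen /= sign_aut2.
- by rewrite [sign_rep (Ue i)]sign_rep_gen.
- by rewrite [sign_rep (Uf i)]sign_rep_gen.
Qed.

End SignAction.
End Actions.

(** * The classification *)

Theorem theorem3p2 (R : realType) (q : R[i]%C)
    (q_neq0 : q != 0)
    (q_not_root1 : forall n : nat, (0 < n)%N -> q ^+ n != 1)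
    (m : nat) (m_ge3 : (3 <= m)%N) :
  (forall act : Uq m q -> qplane q -> qplane q,
     module_algebra Uq_comul Uq_counit act ->
     exists s1 s2 : 'I_m -> bool, sign_action act s1 s2) /\
  (forall s1 s2 : 'I_m -> bool,
     exists! act : Uq m q -> qplane q -> qplane q,
       module_algebra Uq_comul Uq_counit act /\ sign_action act s1 s2).
Proof.
split=> [act actP|s1 s2]; first exact: (action_signs q_neq0 q_not_root1 actP m_ge3).
have actP := sign_rep_module_algebra q_neq0 s1 s2.
exists (fun h : Uq m q => lend_fun (sign_rep s1 s2 h)); split=> [|act [aP sa]].
  by split=> //; apply: sign_rep_signs.
exact: (sign_action_unique q_neq0 actP aP (sign_rep_signs _ _ _)).
Qed.
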